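(* Let $X_n$ denote the height of a random walk of length $n$ with step polynomial $P(u)$. Let $\delta=P'(1)$ be the drift, and $\rho_1=1/P(1)$. 1. For $\delta<0$ the limit distribution is discrete and characterized in terms of the large branches $v_1,\dots,v_d$: for every integer $k\ge0$, $$\lim_{n\to\infty}\mathbb{P}(X_n=k)=[u^k]\,\omega(u),\qquad\text{where}\quad \omega(u)=\prod_{j=1}^d\frac{1-v_j(\rho_1)}{u-v_j(\rho_1)}.$$ 2. For $\delta=0$ the standardized random variable converges to a half-normal distribution: $$\frac{X_n}{\sqrt n}\stackrel{d}{\to}\mathcal{H}\left(\sqrt{\frac{P''(1)}{P(1)}}\right).$$ 3. For $\delta>0$ the standardized random variable converges to a normal distribution: $$\frac{X_n-\mu n}{\sigma\sqrt n}\stackrel{d}{\to}\mathcal{N}(0,1),\qquad \mu=\frac{P'(1)}{P(1)},\qquad \sigma^2=\frac{P''(1)}{P(1)}+\frac{P'(1)}{P(1)}-\left(\frac{P'(1)}{P(1)}\right)^2.$$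
   Context: A step set $\mathcal{S}\subset\mathbb{Z}$ is a finite set of integers containing at least one negative and at least one positive number; each step $s\in\mathcal{S}$ has a weight $p_s>0$. The step polynomial is $P(u)=\sum_{s\in\mathcal{S}}p_su^s$; $c=-\min\mathcal{S}>0$, $d=\max\mathcal{S}>0$. A walk of length $n$ is a sequence $(s_1,\dots,s_n)\in\mathcal{S}^n$, identified with its altitudes $(\omega_0,\dots,\omega_n)$, $\omega_0=0$, $\omega_i-\omega_{i-1}=s_i$. Its weight is the product of the weights of its steps, and a random walk of length $n$ is chosen with probability proportional to its weight. The height of a walk is $\max_{0\le k\le n}\omega_k$. The kernel equation $1-zP(u)=0$, equivalently $u^c-zu^cP(u)=0$, has degree $c+d$ in $u$. For $z$ near $0$ (in the plane slit along the negative real axis) its roots are $c$ small branches $u_1(z),\dots,u_c(z)$ with $u_i(z)\to0$ as $z\to0$, and $d$ large branches $v_1(z),\dots,v_d(z)$ with $|v_j(z)|\to\infty$ as $z\to0$. Let $\tau>0$ be the unique positive real number with $P'(\tau)=0$ and $\rho=1/P(\tau)$; the multiset of large branches is followed continuously along the real interval $(0,\rho)$, which defines the $v_j(\rho_1)$ when $\rho_1<\rho$ (as is the case for $\delta<0$). $[u^k]\omega(u)$ is the coefficient of $u^k$ in the power series expansion of $\omega$ at $u=0$. $\mathcal{H}(\sigma)$ is the half-normal distribution with density $\sqrt{\frac{2}{\pi\sigma^2}}\exp\left(-\frac{x^2}{2\sigma^2}\right)$, $x\ge0$; $\mathcal{N}(0,1)$ is the standard normal distribution. *)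

(* Defs.v *)
From HB Require Import structures.
From mathcomp Require Import all_boot all_order all_fingroup all_algebra finmap.
From mathcomp Require Import complex.
From mathcomp Require Import all_classical all_reals all_analysis.

Set Implicit Arguments.
Unset Strict Implicit.
Unset Printing Implicit Defensive.

Import Order.TTheory GRing.Theory Num.Theory.
Import numFieldNormedType.Exports.

Local Open Scope classical_set_scope.
Local Open Scope ring_scope.
Local Open Scope complex_scope.

Section StepSet.
Variable S : {fset int}.

(* The default 0 in the two extrema is harmless: a step set contains a negative
   and a positive number. *)
Definition step_c : nat := absz (\big[Num.min/0]_(s <- S) s).
Definition step_d : nat := absz (\big[Num.max/0]_(s <- S) s).

Definition altitude (n : nat) (w : n.-tuple S) (k : nat) : int :=
  \sum_(s <- take k w) val s.

(* The default 0 is harmless, since altitude w 0 = 0. *)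
Definition height (n : nat) (w : n.-tuple S) : int :=
  \big[Num.max/0]_(k < n.+1) altitude w k.

Section Weights.
Variables (R : realType) (p : int -> R).

(* P(u) as a function; only its values at u > 0 are meaningful when S contains
   negative steps. *)
Definition step_poly (u : R) : R := \sum_(s <- S) p s * u ^ s.

Definition weight (n : nat) (w : n.-tuple S) : R := \prod_(s <- w) p (val s).

Definition walk_prob (n : nat) (A : pred (n.-tuple S)) : R :=
  (\sum_(w : n.-tuple S | A w) weight w) / (\sum_(w : n.-tuple S) weight w).

Definition walk_cdf (n : nat) (Y : n.-tuple S -> R) (x : R) : R :=
  walk_prob [pred w | Y w <= x].

(* u^c - z u^c P(u), as a polynomial in u; its degree is c + d for z != 0. *)
Definition kernel_poly (z : R[i]) : {poly R[i]} :=
  'X^step_c - z *: \sum_(s <- S) (p s)%:C *: 'X^(absz (s + step_c%:Z)).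

(* The disc of radius r slit along the negative real axis, together with the
   real interval (0, rho). *)
Definition branch_domain (r rho : R) : set (R[i])^o :=
  [set z | `|z| < r%:C /\ ~ (complex.Im z = 0 /\ complex.Re z <= 0)] `|`
  [set z | exists2 x : R, 0 < x < rho & z = x%:C].

(* Continuity on D of z |-> {{v_0(z), ..., v_(m-1)(z)}} as a multiset: nearby
   values agree up to epsilon after a permutation of the indices. *)
Definition multiset_continuous (m : nat) (D : set (R[i])^o)
    (v : 'I_m -> (R[i])^o -> (R[i])^o) : Prop :=
  forall z0, D z0 -> forall e : R[i], 0 < e ->
    \forall z \near within D (nbhs z0),
      exists s : 'S_m, forall j, `|v j z - v (s j) z0| < e.

(* Only the values on D matter. Since D contains a slit neighbourhood of 0, the
   limits select the small roots u and the large roots v there; continuity of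
   the multiset then determines the large roots along (0, rho). *)
Definition kernel_branches (rho : R) (u : 'I_step_c -> (R[i])^o -> (R[i])^o)
    (v : 'I_step_d -> (R[i])^o -> (R[i])^o) : Prop :=
  exists2 r : R, 0 < r &
    let D := branch_domain r rho in
    [/\ forall z, D z -> kernel_poly z = lead_coef (kernel_poly z) *:
          (\prod_i ('X - (u i z)%:P) * \prod_j ('X - (v j z)%:P)),
        forall i, u i z @[z --> within D (nbhs 0)] --> (0 : (R[i])^o),
        forall j, `|v j z| @[z --> within D (nbhs 0)] --> +oo &
        multiset_continuous D v].

Definition omega (v : 'I_step_d -> (R[i])^o -> (R[i])^o) (z u : (R[i])^o) :
    (R[i])^o :=
  \prod_j ((1 - v j z) / (u - v j z)).

End Weights.
End StepSet.

Section Limits.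
Variable R : realType.

Definition power_series_at0 (f : (R[i])^o -> (R[i])^o) (a : nat -> (R[i])^o) :
    Prop :=
  \forall u \near 0, series (fun k => a k * u ^+ k) @ \oo --> f u.

Definition half_normal_pdf (sigma x : R) : R :=
  if 0 <= x then
    Num.sqrt (2 / (pi * sigma ^+ 2)) * expR (- (x ^+ 2 / (2 * sigma ^+ 2)))
  else 0.

Definition half_normal (sigma : R) (A : set R) : \bar R :=
  (\int[lebesgue_measure]_(x in A) (half_normal_pdf sigma x)%:E)%E.

(* Convergence in distribution to the law mu of the real random variables with
   cumulative distribution functions F n. *)
Definition cvg_in_distribution (F : nat -> R -> R) (mu : set R -> \bar R) :
    Prop :=
  let G (x : R) := fine (mu `]-oo, x]%classic) in
  forall x, {for x, continuous G} -> F n x @[n --> \oo] --> G x.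

End Limits.

(* Main.v *)
Require Import Defs.
From HB Require Import structures.
From mathcomp Require Import all_boot all_order all_fingroup all_algebra finmap.
From mathcomp Require Import complex.
From mathcomp Require Import all_classical all_reals all_analysis.
From mathcomp Require Import ring lra.

Set Implicit Arguments.
Unset Strict Implicit.
Unset Printing Implicit Defensive.

Import Order.TTheory GRing.Theory Num.Theory.
Import numFieldNormedType.Exports.

Local Open Scope classical_set_scope.
Local Open Scope ring_scope.
Local Open Scope complex_scope.

(** Write pi_s = p_s / P(1) for the step probabilities and q_n(y) for the
    probability that a walk of length n has height at most y.  Conditioning on
    the first step gives
      q_{n+1}(y) = sum_s pi_s q_n(y - s) for y >= 0,   q_n(y) = 0 for y < 0,
    with q_0 = 1 on y >= 0 (stay_prob, walk_prob_height_le).  All three limits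
    are obtained by comparing q_n with an explicit solution, exact or
    approximate, of this recursion; monotonicity of the recursion then gives
    the error bounds.

    Zero and positive drift.  Let mu and v be the mean and variance of a step.
    With Phi the standard normal distribution function, the functions
      G(m, y) = Phi ((y - mu m + alpha) / sqrt (v (m + beta)))
    solve the heat equation with drift, so a Taylor expansion (heat_step) shows
    that they satisfy sum_s pi_s G(m, y - s) = G(m + 1, y) up to an error
    O((v beta)^(-3/2)).  This is summable over n steps to something negligible
    as soon as beta is much larger than n^(2/3), and the initial value of
    G is close to the indicator of y >= 0 as soon as alpha is much larger than
    sqrt beta.  The
    choice sqrt n = A^8, beta = A^12, alpha = +- sqrt v A^7 with A = n^(1/16)
    satisfies both requirements, while alpha and beta disappear at the scales
    sqrt n and n.  For mu > 0 the boundary condition at y < 0 is harmless,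
    because G is already small there at all times (heat_sol_neg_le).  For
    mu = 0 the odd function 2 Phi - 1 vanishes on the boundary, and replaces
    Phi: this is the reflection principle for the heat equation.  The half
    normal and normal limits follow (stay_cvg_half_normal, stay_cvg_normal).

    Negative drift.  Bernoulli's inequality for integer powers, summed over the
    steps, says that P lies strictly above its tangents; hence tau > 1 and
    P(tau) < P(1).  For 0 < z < 1 / P(tau) the kernel has no root of modulus
    tau, so the large branches, which are outside the circle |u| = tau near
    z = 0 and move continuously, stay outside along (0, 1 / P(tau))
    (branch_large); in particular this holds at rho_1.  Let
    b_k be the coefficients of prod_j 1 / (1 - u / v_j), V their sum and
    q(y) = (b_0 + ... + b_y) / V.  Since 1 is a root of the kernel which is
    not one of the v_j, multiplying the series sum_y q(y) u^y by the kernel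
    leaves a polynomial of degree less than c; read off coefficientwise,
    this says that q satisfies exactly the recursion of the q_n
    (kernel_recurrence).  Finally 1 - q(y) = O(tau^(-y)), and the recursion
    contracts the norm sup_y tau^y |f(y)| by the factor P(tau) / P(1) < 1
    (weighted_contraction); so q_n tends to q, and the limit law has generating
    function (1 - u) sum_y q(y) u^y = omega(u). *)

(** * First-step recursion for the height *)

Section Walks.
Variables (R : realType) (S : {fset int}) (p : int -> R).

Lemma big_tupleS (n : nat) (F : n.+1.-tuple S -> R) :
  \sum_w F w = \sum_(s : S) \sum_(w : n.-tuple S) F [tuple of s :: w].
Proof.
rewrite pair_big /= (reindex (fun sw : S * n.-tuple S => [tuple of sw.1 :: sw.2])) //=.
exists (fun w : n.+1.-tuple S => (thead w, [tuple of behead w])) => [[s w] _|w _] /=.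
  by congr pair; apply: val_inj.
by rewrite [RHS]tuple_eta; apply: val_inj.
Qed.

Lemma height_leP (n : nat) (w : n.-tuple S) (m : int) :
  reflect (0 <= m /\ forall k, (k <= n)%N -> altitude w k <= m) (height w <= m).
Proof.
rewrite /height; apply: (iffP idP) => [/bigmax_leP|] [m0 H].
  by split=> // k kn; have := H (Ordinal (kn : (k < n.+1)%N)) isT.
by apply/bigmax_leP; split=> // k _; apply: H; rewrite -ltnS.
Qed.

(** The altitudes of [s :: w] are 0 and those of [w] shifted by [s]. *)
Lemma height_cons (n : nat) (s : S) (w : n.-tuple S) (m : int) :
  (height [tuple of s :: w] <= m) = (0 <= m) && (height w <= m - val s).
Proof.
apply/height_leP/andP => [[m0 H]|[m0 /height_leP[ms H]]]; split => //.
- apply/height_leP; split=> [|k kn].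
    have := H 1%N isT; rewrite /altitude /= take0 big_cons big_nil addr0.
    by rewrite subr_ge0.
  by have := H k.+1 kn; rewrite /altitude /= big_cons addrC -lerBrDr.
- case=> [_|k kn]; first by rewrite /altitude /= big_nil.
  by rewrite /altitude /= big_cons addrC -lerBrDr; apply: H.
Qed.

Lemma height_ge0 (n : nat) (w : n.-tuple S) : 0 <= height w.
Proof.
rewrite /height; apply: le_trans (le_bigmax _ _ ord0).
by rewrite /altitude /= take0 big_nil.
Qed.

(** The boundary value 0 below the origin also covers [y < 0] at time 0, since
    a height is never negative.  The level [y] is real so that the
    comparison functions can be evaluated at unrounded arguments. *)
Fixpoint stay_prob (n : nat) (y : R) : R :=
  if y < 0 then 0 else
  if n is m.+1 then \sum_(s <- S) p s / step_poly S p 1 * stay_prob m (y - s%:~R)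
  else 1.

Hypothesis P1 : 0 < step_poly S p 1.

Lemma step_poly1 : step_poly S p 1 = \sum_(s <- S) p s.
Proof. by apply: eq_bigr => s _; rewrite exp1rz mulr1. Qed.

Lemma weight_cons (n : nat) (s : S) (w : n.-tuple S) :
  weight p [tuple of s :: w] = p (val s) * weight p w.
Proof. by rewrite /weight /= big_cons. Qed.

Lemma total_weight (n : nat) : \sum_(w : n.-tuple S) weight p w = step_poly S p 1 ^+ n.
Proof.
elim: n => [|n IH].
  rewrite expr0 (big_pred1 [tuple]) ?/weight ?big_nil// => w.
  by apply/esym/eqP; rewrite tuple0.
rewrite big_tupleS exprS -IH step_poly1 (big_seq_fsetE _ _ predT) /= mulr_suml.
by apply: eq_bigr => s _; rewrite mulr_sumr; apply: eq_bigr => w _; rewrite weight_cons.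
Qed.

Lemma walk_prob_sum (n : nat) (A : pred (n.-tuple S)) :
  walk_prob p A = (\sum_(w : n.-tuple S) (A w)%:R * weight p w) / step_poly S p 1 ^+ n.
Proof.
rewrite /walk_prob total_weight big_mkcond; congr (_ / _).
by apply: eq_bigr => w _; case: (A w); rewrite ?mul1r ?mul0r.
Qed.

Lemma walk_prob_height_le (n : nat) (y : R) :
  walk_prob p (fun w : n.-tuple S => (height w)%:~R <= y) = stay_prob n y.
Proof.
elim: n y => [|n IH] y; rewrite walk_prob_sum /=.
  rewrite (big_pred1 [tuple]) => [|w]; last by apply/esym/eqP; rewrite tuple0.
  rewrite /weight big_nil expr0 divr1 mulr1.
  have -> : height ([tuple] : 0.-tuple S) = 0.
    by rewrite /height big_ord_recl big_ord0 /altitude /= big_nil maxxx.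
  by rewrite ltNge; case: (0 <= y).
rewrite big_tupleS.
have E (s : S) (w : n.-tuple S) : ((height [tuple of s :: w])%:~R <= y) =
    (0 <= y) && ((height w)%:~R <= y - (val s)%:~R).
  rewrite lerBrDr -intrD -!floor_ge_int height_cons lerBrDr.
  by rewrite (floor_ge_int y 0).
case: ltrP => y0.
  rewrite big1 ?mul0r// => s _; rewrite big1// => w _.
  by rewrite E leNgt y0 mul0r.
rewrite (big_seq_fsetE _ _ predT) /= mulr_suml; apply: eq_bigr => s _.
rewrite -IH walk_prob_sum mulrA mulr_sumr !mulr_suml; apply: eq_bigr => w _.
by rewrite E y0 weight_cons exprS invfM; ring.
Qed.

End Walks.

(** * Convexity of the step polynomial *)

Section StepPolynomial.
Variables (R : realType) (S : {fset int}) (p : int -> R).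

Lemma is_derive_exprz (k : int) (x : R) : x != 0 ->
  is_derive x 1 (fun u : R => u ^ k) (k%:~R * x ^ (k - 1)).
Proof.
move=> x0; case: k => n.
  have := is_deriveX n (is_derive_id x (1:R)); rewrite fctE => /is_derive_eq; apply.
  case: n => [|n]; first by rewrite !mul0r scale0r.
  by rewrite intS addrAC subrr add0r [LHS]mulr1 -pmulrn.
have x1 : x ^+ n.+1 != 0 by rewrite expf_neq0.
have := is_deriveX n.+1 (is_derive_id x (1:R)); rewrite fctE => H.
have := @is_deriveV _ (fun u => u ^+ n.+1) x _ 1 x1 H => /is_derive_eq; apply.
have -> : Negz n - 1 = Negz n.+1 by rewrite !NegzE -opprD (intS n.+1) addrC.
rewrite NegzE mulrNz /= -[x ^ Negz _]/(x ^- n.+2) /GRing.scale /= mulr1 -pmulrn.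
by rewrite !exprS; field; rewrite x0 expf_neq0.
Qed.

Lemma is_derive_big (I : Type) (r : seq I) (f : I -> R -> R) (df : I -> R) (x : R) :
  (forall i, is_derive x 1 (f i) (df i)) ->
  is_derive x 1 (fun u => \sum_(i <- r) f i u) (\sum_(i <- r) df i).
Proof.
move=> H; elim: r => [|i r IH].
  rewrite big_nil.
  under eq_fun do rewrite big_nil.
  exact: is_derive_cst.
rewrite big_cons; under eq_fun do rewrite big_cons.
exact: is_deriveD.
Qed.

Lemma derive1_near (f g : R -> R) (x : R) :
  (\forall u \near x, f u = g u) -> f^`()%classic x = g^`()%classic x.
Proof. move=> fg; rewrite !derive1E; apply: near_eq_derive => //. Qed.

Lemma step_poly_derive1 (x : R) : 0 < x ->
  (step_poly S p)^`()%classic x = \sum_(s <- S) p s * (s%:~R * x ^ (s - 1)).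
Proof.
move=> x0; rewrite derive1E; apply: derive_val.
apply: is_derive_big => s; apply: is_deriveZ.
by apply: is_derive_exprz; rewrite gt_eqF.
Qed.

Lemma step_poly_derive2 : (step_poly S p)^`()^`()%classic 1 =
  \sum_(s <- S) p s * (s%:~R * (s%:~R - 1)).
Proof.
rewrite (@derive1_near _ (fun u => \sum_(s <- S) p s * (s%:~R * u ^ (s - 1)))); last first.
  near=> u; apply: step_poly_derive1; near: u; exact: lt_nbhsr.
rewrite derive1E.
have -> : \sum_(s <- S) p s * (s%:~R * (s%:~R - 1)) =
    \sum_(s <- S) p s * (s%:~R * ((s - 1)%:~R * 1 ^ (s - 1 - 1))) :> R.
  by apply: eq_bigr => s _; rewrite exp1rz mulr1 intrB.
apply: derive_val; apply: is_derive_big => s; apply: is_deriveZ; apply: is_deriveZ.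
by apply: is_derive_exprz; rewrite oner_neq0.
Unshelve. all: by end_near. Qed.

Lemma bernoulli_nat (x : R) (n : nat) : 0 < x -> 1 + n%:R * (x - 1) <= x ^+ n.
Proof.
move=> x0; elim: n => [|n IH]; first by rewrite mul0r addr0.
rewrite exprS; apply: le_trans (ler_wpM2l (ltW x0) IH).
have : 0 <= n%:R * (x - 1) ^+ 2 by rewrite mulr_ge0 ?sqr_ge0.
by rewrite -natr1; lra.
Qed.

(** Bernoulli's inequality for [x^-1], followed by
    [x^-1 - 1 - (1 - x) = (x - 1)^2 / x > 0]; this is where strictness comes
    from. *)
Lemma bernoulli_neg (x : R) (n : nat) : 0 < x -> x != 1 ->
  1 - n.+1%:R * (x - 1) < x ^- n.+1.
Proof.
move=> x0 x1.
have := @bernoulli_nat x^-1 n.+1; rewrite invr_gt0 exprVn => /(_ x0).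
apply: lt_le_trans; rewrite ltrD2l -mulrN ltr_pM2l ?ltr0n// opprB -subr_gt0.
have -> : x^-1 - 1 - (1 - x) = (x - 1) ^+ 2 / x by field; rewrite gt_eqF.
by rewrite divr_gt0// exprn_even_gt0//= subr_eq0.
Qed.

Lemma bernoulli_int (x : R) (k : int) : 0 < x -> 1 + k%:~R * (x - 1) <= x ^ k.
Proof.
move=> x0; case: k => n; first by rewrite -pmulrn; apply: bernoulli_nat.
have [->|x1] := eqVneq x 1; first by rewrite subrr mulr0 addr0 exp1rz.
by apply: ltW; rewrite NegzE mulrNz mulNr -pmulrn; apply: bernoulli_neg.
Qed.

Hypothesis p_gt0 : forall s, s \in S -> 0 < p s.

(** Term by term, the difference is [p_s x^s] times the defect in
    Bernoulli's inequality for [(y / x)^s]; the negative step makes it strict,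
    although the power itself may be affine for the other steps. *)
Lemma step_poly_tangent (x y : R) : (exists2 s, s \in S & s < 0) ->
  0 < x -> 0 < y -> x != y ->
  step_poly S p x + (y - x) * (step_poly S p)^`()%classic x < step_poly S p y.
Proof.
move=> [s0 s0S s0_lt0] x0 y0 xy.
have yx1 : y / x != 1.
  by apply: contra_neq xy => yx; rewrite -[y](@divfK _ x) ?gt_eqF// yx mul1r.
have E s : p s * y ^ s - (p s * x ^ s + (y - x) * (p s * (s%:~R * x ^ (s - 1)))) =
    p s * x ^ s * ((y / x) ^ s - (1 + s%:~R * (y / x - 1))).
  have -> : x ^ (s - 1) = x ^ s / x by rewrite expfzDr ?gt_eqF.
  by rewrite expfzMl exprz_inv -invr_expz; field; rewrite expfz_neq0 ?gt_eqF.
rewrite step_poly_derive1// mulr_sumr -big_split /= -subr_gt0 -sumrB.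
under eq_bigr do rewrite E.
rewrite (big_fsetD1 s0)//= ltr_pwDl//.
  rewrite mulr_gt0 ?mulr_gt0 ?p_gt0 ?exprz_gt0// subr_gt0.
  case: s0 s0_lt0 {s0S} => // n _; rewrite NegzE mulrNz mulNr -pmulrn.
  by apply: bernoulli_neg; rewrite ?divr_gt0.
rewrite big_seq_cond; apply: sumr_ge0 => s; rewrite !inE andbT => /andP[_ sS].
rewrite mulr_ge0 ?subr_ge0 ?bernoulli_int ?divr_gt0//.
by rewrite ltW// mulr_gt0 ?p_gt0 ?exprz_gt0.
Qed.

End StepPolynomial.

(** * The normal distribution function *)

Section Gaussian.
Variable R : realType.
Implicit Types x y h : R.

Local Notation phi := (normal_pdf (0:R) 1).

Definition normal_cdf x : R := fine (normal_prob 0 1 `]-oo, x]%classic).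
Local Notation Phi := normal_cdf.

Lemma normal_cdfE x : (Phi x)%:E = normal_prob 0 1 `]-oo, x]%classic.
Proof. by rewrite /normal_cdf fineK// fin_num_measure. Qed.

Lemma normal_cdf_ge0 x : 0 <= Phi x.
Proof. by rewrite fine_ge0. Qed.

Lemma normal_cdf_le1 x : Phi x <= 1.
Proof. by rewrite -lee_fin normal_cdfE probability_le1. Qed.

Lemma normal_cdf_le x y : x <= y -> Phi x <= Phi y.
Proof.
move=> xy; rewrite -lee_fin !normal_cdfE le_measure ?inE//.
by apply: subset_itvl; rewrite bnd_simp.
Qed.

Let idR : measurableTypeR R -> R := idfun.

#[local] HB.instance Definition _ :=
  @isMeasurableFun.Build _ _ _ _ idR (@measurable_id _ _ setT).

Let cdf_idR x : cdf (idR : {RV normal_prob (0:R) 1 >-> R}) x = (Phi x)%:E.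
Proof. by rewrite normal_cdfE. Qed.

Lemma normal_cdf_cvgy : Phi x @[x --> +oo] --> (1 : R).
Proof.
apply: (@fine_cvg _ _ _ _ (fun x => (Phi x)%:E)).
have -> : (fun x => (Phi x)%:E) = cdf (idR : {RV normal_prob (0:R) 1 >-> R}).
  by apply/funext => x; rewrite cdf_idR.
exact: cvg_cdfy1.
Qed.

Lemma normal_cdf_cvgNy : Phi x @[x --> -oo] --> (0 : R).
Proof.
apply: (@fine_cvg _ _ _ _ (fun x => (Phi x)%:E)).
have -> : (fun x => (Phi x)%:E) = cdf (idR : {RV normal_prob (0:R) 1 >-> R}).
  by apply/funext => x; rewrite cdf_idR.
exact: cvg_cdfNy0.
Qed.

Lemma is_derive_normal_cdf x : is_derive x 1 Phi (phi x).
Proof.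
have c1 : {for x, continuous phi} by apply: continuous_normal_pdf; rewrite oner_neq0.
have i1 : lebesgue_measure.-integrable [set` `]-oo, (x + 1)]] (EFin \o phi).
  by apply: integrableS (integrable_normal_pdf 0 1).
have x1 : x < x + 1 by rewrite ltrDl.
have [d1 d2] := continuous_FTC1 x1 i1 (ltNyr _) c1.
by rewrite -d2 derive1E; apply: derivableP.
Qed.

Lemma normal_pdf01E x : phi x = normal_peak 1 * expR (- (x ^+ 2 / 2)).
Proof. by rewrite normal_pdfE ?oner_neq0// /normal_fun subr0 expr1n mulNr. Qed.

Lemma is_derive_normal_pdf x : is_derive x 1 phi (- x * phi x).
Proof.
have dX : is_derive x 1 (fun x : R => x ^+ 2) (2 * x).
  have := is_deriveX 2 (is_derive_id x (1:R)); rewrite fctE => /is_derive_eq; apply.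
  by rewrite /= expr1 [LHS]mulr1.
have -> : - x * phi x = normal_peak 1 *: (expR (- (2^-1 * x ^+ 2)) * (- (2^-1 * (2 * x)))).
  by rewrite normal_pdf01E [RHS]/GRing.scale /= [2^-1 * x ^+ 2]mulrC; field.
have -> : phi = normal_peak 1 *: (expR \o (- (2^-1 *: (fun x : R => x ^+ 2)))).
  apply/funext => y; rewrite normal_pdf01E !fctE /=.
  by congr (_ * expR (- _)); rewrite mulrC.
by apply: is_deriveZ; apply: is_derive1_comp.
Qed.

Lemma normal_pdfN x : phi (- x) = phi x.
Proof. by rewrite !normal_pdf01E sqrrN. Qed.

(** The sum [Phi x + Phi (- x)] has zero derivative and tends to 1. *)
Lemma normal_cdfN x : Phi (- x) = 1 - Phi x.
Proof.
pose f := Phi + (Phi \o -%R).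
have df y : is_derive y 1 f 0.
  rewrite -[0](subrr (phi y)) -[X in _ - X]normal_pdfN -mulrN1.
  apply: is_deriveD; first exact: is_derive_normal_cdf.
  exact: is_derive1_comp (is_derive_normal_cdf _) _.
have f1 : f y @[y --> +oo] --> (1 : R).
  rewrite -[1]addr0; apply: cvgD; first exact: normal_cdf_cvgy.
  exact: (proj1 (cvgNy_compNP Phi _) normal_cdf_cvgNy).
have fx : f y @[y --> +oo] --> f x.
  rewrite (_ : f = cst (f x)); first exact: cvg_cst.
  by apply/funext => y; apply: is_derive_0_is_cst.
have : f x = 1 by apply: cvg_unique fx f1.
by rewrite /f fctE /=; lra.
Qed.

Lemma normal_cdf0 : Phi 0 = 2^-1.
Proof. by have := normal_cdfN 0; rewrite oppr0; lra. Qed.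

Lemma normal_peak1_bounds : 0 < normal_peak (1:R) <= 1.
Proof.
rewrite normal_peak_gt0 ?oner_neq0//= /normal_peak expr1n mul1r.
have pi2 : 1 <= pi *+ 2 :> R by have := pi_ge2 R; lra.
have := ler_wsqrtr pi2; rewrite sqrtr1 => s1.
by rewrite invf_le1// (lt_le_trans ltr01).
Qed.

(** A single polynomial bound on the decay of the density, from
    [exp t >= (1 + t / 2) ^ 2]; it is strong enough to bound the density times
    any polynomial of degree at most 4. *)
Lemma normal_pdf_decay x : (1 + x ^+ 2 / 4) ^+ 2 * phi x <= 1.
Proof.
have /andP[k0 k1] := normal_peak1_bounds.
rewrite normal_pdf01E mulrCA; apply: le_trans k1.
rewrite ger_pMr// expRN ler_pdivrMr ?expR_gt0// mul1r.
have -> : x ^+ 2 / 2 = x ^+ 2 / 4 * 2 by field.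
rewrite expRM_natr lerXn2r ?nnegrE ?expR_ge0 ?expR_ge1Dx//.
by rewrite addr_ge0// divr_ge0// sqr_ge0.
Qed.

Lemma normal_pdf_le (k : R) (c x : R) : 0 <= c ->
  k <= c * (1 + x ^+ 2 / 4) ^+ 2 -> k * phi x <= c.
Proof.
move=> c0 kc; apply: le_trans (ler_wpM2r (normal_pdf_ge0 _ _ _) kc) _.
by rewrite -mulrA ler_piMr// normal_pdf_decay.
Qed.

Lemma normal_pdf_derive_le x : `|- x * phi x| <= 1.
Proof.
rewrite normrM normrN (ger0_norm (normal_pdf_ge0 _ _ _)).
apply: normal_pdf_le => //; rewrite -[x ^+ 2]real_normK ?num_real//.
by set a := `|x|; nra.
Qed.

Lemma is_derive_normal_pdf_derive x :
  is_derive x 1 (fun y => - y * phi y) ((x ^+ 2 - 1) * phi x).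
Proof.
have := is_deriveM (is_deriveN (is_derive_id x (1:R))) (is_derive_normal_pdf x).
rewrite fctE => /is_derive_eq; apply.
have E : - x * (- x * phi x) + phi x * (- 1) = (x ^+ 2 - 1) * phi x by ring.
exact: E.
Qed.

Lemma normal_pdf_derive2_le x : `|(x ^+ 2 - 1) * phi x| <= 4.
Proof.
rewrite normrM (ger0_norm (normal_pdf_ge0 _ _ _)).
by apply: normal_pdf_le => //; rewrite ler_norml; have := sqr_ge0 x; nra.
Qed.

Lemma normal_pdf_cube_le x : `|x| ^+ 3 * phi x <= 16.
Proof.
apply: normal_pdf_le => //; rewrite -[x ^+ 2]real_normK ?num_real//.
have := sqr_ge0 (`|x| * (`|x| - 2^-1)); have := normr_ge0 x.
by set a := `|x| => a0 H; nra.
Qed.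

End Gaussian.

(** * One step of the walk against the heat equation *)

Section GaussianTaylor.
Variable R : realType.
Local Notation phi := (normal_pdf (0:R) 1).
Local Notation Phi := (@normal_cdf R).

(** A bound on the derivative of order [k] is turned into a Taylor remainder
    bound by using this [k] times, at the cost of a
    factorial in the constant. *)
Lemma norm_primitive_le (g dg : R -> R) (r K : R) (n : nat) : 0 <= K ->
  g 0 = 0 -> (forall t : R, is_derive t 1 g (dg t)) ->
  (forall t, `|t| <= r -> `|dg t| <= K * `|t| ^+ n) ->
  forall t, `|t| <= r -> `|g t| <= K * `|t| ^+ n.+1.
Proof.
move=> K0 g0 gd dgK t tr.
have cg (A : set R) : {within A, continuous g}.
  apply: continuous_subspaceT => x.
  by apply/differentiable_continuous/derivable1_diffP; case: (gd x).
have step c : `|c| <= `|t| -> `|dg c * t| <= K * `|t| ^+ n.+1.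
  move=> ct; rewrite normrM exprSr mulrA ler_wpM2r//.
  apply: le_trans (dgK c (le_trans ct tr)) _.
  by rewrite ler_wpM2l ?lerXn2r ?nnegrE.
have [t0|t0] := leP 0 t.
  have [c] := MVT_segment t0 (fun x _ => gd x) (cg _).
  rewrite in_itv /= => /andP[c0 ct]; rewrite g0 !subr0 => ->.
  by apply: step; rewrite !ger0_norm.
have [c] := MVT_segment (ltW t0) (fun x _ => gd x) (cg _).
rewrite in_itv /= => /andP[ct c0]; rewrite g0 !sub0r => /(congr1 -%R).
rewrite opprK mulrN opprK => ->.
by apply: step; rewrite !ler0_norm ?lerN2// ltW.
Qed.

Lemma is_derive_line (F : R -> R) (dF a b t : R) :
  is_derive (a + t * b) 1 F dF -> is_derive t 1 (fun t => F (a + t * b)) (dF * b).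
Proof.
move=> dFt; have -> : (fun t => F (a + t * b)) = F \o (fun t => a + t * b) by [].
apply: is_derive1_comp.
have -> : (fun t => a + t * b) = cst a + b *: id.
  by apply/funext => u; rewrite !fctE /= mulrC.
have := is_deriveD (is_derive_cst a t (1:R)) (is_deriveZ b (is_derive_id t (1:R))).
by move=> /is_derive_eq; apply; rewrite add0r [LHS]mulr1.
Qed.

Lemma is_derive_quadratic (a b c t : R) :
  is_derive t 1 (fun t => a + t * b + t ^+ 2 / 2 * c) (b + t * c).
Proof.
have := is_deriveD (@is_derive_line id 1 a b t _)
  (is_deriveZ (c / 2) (is_deriveX 2 (is_derive_id t (1:R)))).
rewrite fctE => /(_ (is_derive_id _ _)).
rewrite [X in is_derive _ _ X _](_ : _ = (fun t => a + t * b + t ^+ 2 / 2 * c)); last first.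
  apply/funext => u.
  have E : a + u * b + c / 2 * u ^+ 2 = a + u * b + u ^+ 2 / 2 * c by ring.
  exact: E.
move=> /is_derive_eq; apply.
have E : 1 * b + c / 2 * (2%:R * t ^+ 1 * 1) = b + t * c by field.
exact: E.
Qed.

Lemma normal_cdf_taylor3 (y h : R) :
  `|Phi (y + h) - (Phi y + h * phi y + h ^+ 2 / 2 * (- y * phi y))| <= 4 * `|h| ^+ 3.
Proof.
have d1 (t : R) : is_derive t 1 (fun t => - (y + t * 1) * phi (y + t * 1) - (- y * phi y))
    (((y + t * 1) ^+ 2 - 1) * phi (y + t * 1)).
  have := is_deriveB (is_derive_line (is_derive_normal_pdf_derive (y + t * 1)))
    (is_derive_cst (- y * phi y) t (1:R)).
  by move=> /is_derive_eq; apply; rewrite subr0 mulr1.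
have d2 (t : R) : is_derive t 1
    (fun t => phi (y + t * 1) - (phi y + t * (- y * phi y) + t ^+ 2 / 2 * 0))
    (- (y + t * 1) * phi (y + t * 1) - (- y * phi y)).
  have := is_deriveB (is_derive_line (is_derive_normal_pdf (y + t * 1)))
    (is_derive_quadratic (phi y) (- y * phi y) 0 t).
  by move=> /is_derive_eq; apply; rewrite mulr0 addr0 mulr1.
have d3 (t : R) : is_derive t 1
    (fun t => Phi (y + t * 1) - (Phi y + t * phi y + t ^+ 2 / 2 * (- y * phi y)))
    (phi (y + t * 1) - (phi y + t * (- y * phi y) + t ^+ 2 / 2 * 0)).
  have := is_deriveB (is_derive_line (is_derive_normal_cdf (y + t * 1)))
    (is_derive_quadratic (Phi y) (phi y) (- y * phi y) t).
  by move=> /is_derive_eq; apply; rewrite mulr0 addr0 mulr1.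
have b0 t : `|t| <= `|h| -> `|((y + t * 1) ^+ 2 - 1) * phi (y + t * 1)| <= 4 * `|t| ^+ 0.
  by move=> _; rewrite expr0 [4 * 1]mulr1 normal_pdf_derive2_le.
have K0 : 0 <= 4 :> R by [].
have z1 : - (y + 0 * 1) * phi (y + 0 * 1) - (- y * phi y) = 0.
  by rewrite mul0r addr0 subrr.
have z2 : phi (y + 0 * 1) - (phi y + 0 * (- y * phi y) + 0 ^+ 2 / 2 * 0) = 0.
  by rewrite mulr0 !mul0r !addr0 subrr.
have z3 : Phi (y + 0 * 1) - (Phi y + 0 * phi y + 0 ^+ 2 / 2 * (- y * phi y)) = 0.
  by rewrite expr0n /= !mul0r !addr0 subrr.
have b1 := norm_primitive_le K0 z1 d1 b0.
have b3 := norm_primitive_le K0 z3 d3 (norm_primitive_le K0 z2 d2 b1).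
by have := b3 h (lexx _); rewrite mulr1.
Qed.

(** Second derivative of [t |-> Phi ((1 + t) y)]: with [z = (1 + t) y] it is
    [- y^2 z phi z], and [|t| <= 1/2] gives [y^2 <= 4 z^2]. *)
Lemma normal_cdf_scale (y l : R) : `|l - 1| <= 2^-1 ->
  `|Phi (l * y) - (Phi y + (l - 1) * (y * phi y))| <= 64 * (l - 1) ^+ 2.
Proof.
have d1 (t : R) : is_derive t 1 (fun t => phi (y + t * y) * y - phi y * y)
    (- (y + t * y) * phi (y + t * y) * y * y).
  have := is_deriveB (is_deriveZ y (is_derive_line (is_derive_normal_pdf (y + t * y))))
    (is_derive_cst (phi y * y) t (1:R)).
  rewrite [X in is_derive _ _ X _](_ : _ = (fun t => phi (y + t * y) * y - phi y * y)); last first.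
    apply/funext => u.
    have E : y * phi (y + u * y) - phi y * y = phi (y + u * y) * y - phi y * y by ring.
    exact: E.
  move=> /is_derive_eq; apply; rewrite subr0.
  exact: mulrC.
have d2 (t : R) : is_derive t 1
    (fun t => Phi (y + t * y) - (Phi y + t * (phi y * y) + t ^+ 2 / 2 * 0))
    (phi (y + t * y) * y - phi y * y).
  have := is_deriveB (is_derive_line (is_derive_normal_cdf (y + t * y)))
    (is_derive_quadratic (Phi y) (phi y * y) 0 t).
  by move=> /is_derive_eq; apply; rewrite mulr0 addr0.
have b0 t : `|t| <= 2^-1 -> `|- (y + t * y) * phi (y + t * y) * y * y| <= 64 * `|t| ^+ 0.
  move=> t2; rewrite expr0 mulr1; set z := y + t * y.
  have yz : y ^+ 2 <= 4 * z ^+ 2.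
    have -> : z = (1 + t) * y by rewrite /z; ring.
    have /andP[t3 _] : - 2^-1 <= t <= 2^-1 by rewrite -ler_norml.
    rewrite exprMn mulrA ler_peMl ?sqr_ge0//.
    nra.
  have -> : `|- z * phi z * y * y| = y ^+ 2 * (`|z| * phi z).
    rewrite -mulrA -expr2 normrM normrM normrN (ger0_norm (sqr_ge0 y)).
    by rewrite (ger0_norm (normal_pdf_ge0 _ _ _)) mulrC.
  apply: le_trans (ler_wpM2r _ yz) _; first by rewrite mulr_ge0 ?normal_pdf_ge0.
  have := normal_pdf_cube_le z; rewrite -[z ^+ 2]real_normK ?num_real// exprS.
  by set a := `|z|; set b := phi z; lra.
have K0 : 0 <= 64 :> R by [].
have z1 : phi (y + 0 * y) * y - phi y * y = 0 by rewrite mul0r addr0 subrr.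
have z2 : Phi (y + 0 * y) - (Phi y + 0 * (phi y * y) + 0 ^+ 2 / 2 * 0) = 0.
  by rewrite mulr0 !mul0r !addr0 subrr.
move=> lr; have := norm_primitive_le K0 z2 d2 (norm_primitive_le K0 z1 d1 b0) lr.
rewrite real_normK ?num_real// mulr0 addr0 [y * _]mulrC.
by have -> : y + (l - 1) * y = l * y by ring.
Qed.

(** With [l = sqrt (t / (t + v))] one has [v / t = (1 - l) (1 + l) / l^2],
    from which the expansion of [l] in [v / t] is read off rationally. *)
Lemma sqrt_ratio_expansion (t v : R) : 1 <= t -> 0 <= v <= t ->
  let l := Num.sqrt t / Num.sqrt (t + v) in
  `|l - 1| <= 2^-1 /\ (l - 1) ^+ 2 <= v ^+ 2 / t ^+ 2 /\
  `|1 - l - v / (2 * t)| <= 6 * (l - 1) ^+ 2.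
Proof.
move=> t1 /andP[v0 vt] l.
have t0 : 0 < t by lra.
have tv0 : 0 < t + v by lra.
have s0 : 0 < Num.sqrt (t + v) by rewrite sqrtr_gt0.
have l0 : 0 < l by rewrite divr_gt0 ?sqrtr_gt0.
have l2 : l ^+ 2 * (t + v) = t.
  by rewrite exprMn exprVn !sqr_sqrtr ?divfK ?gt_eqF// ltW.
clearbody l; have l20 : 0 < l ^+ 2 by rewrite exprn_gt0.
have l2_ge0 := sqr_ge0 l.
have l1 : l <= 1.
  rewrite -(@ler_pXn2r _ 2) ?nnegrE ?(ltW l0)// expr1n -(ler_pM2r t0) mul1r.
  by rewrite -[leRHS]l2 ler_wpM2l// lerDl.
have lh : 2^-1 <= l.
  rewrite -(@ler_pXn2r _ 2) ?nnegrE ?(ltW l0)//.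
  have : 2^-1 <= l ^+ 2.
    rewrite -(ler_pM2r t0); have : l ^+ 2 * (t + v) <= l ^+ 2 * (t + t).
      by rewrite ler_wpM2l// lerD2l.
    by rewrite l2; lra.
  lra.
have vE : v = t * ((1 - l) * (1 + l) / l ^+ 2).
  apply: (mulIf (lt0r_neq0 l20)); rewrite -[RHS]mulrA divfK ?gt_eqF//; lra.
have nE : `|l - 1| = 1 - l by rewrite distrC ger0_norm// subr_ge0.
split; first by rewrite nE; lra.
split.
  have -> : v ^+ 2 / t ^+ 2 = (v / t) ^+ 2 by rewrite exprMn exprVn.
  rewrite -real_normK ?num_real// nE lerXn2r ?nnegrE ?subr_ge0 ?(divr_ge0 _ (ltW t0))//.
  rewrite vE mulrC mulKf ?gt_eqF// ler_pdivlMr//.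
  by rewrite ler_wpM2l ?subr_ge0//; nra.
have -> : 1 - l - v / (2 * t) = - ((1 - l) ^+ 2 * ((1 + 2 * l) / (2 * l ^+ 2))).
  by rewrite vE; field; rewrite !gt_eqF.
rewrite normrN normrM -[in leRHS]real_normK ?num_real// nE.
rewrite (ger0_norm (sqr_ge0 _)) mulrC ler_wpM2r ?sqr_ge0//.
have lhl : 2^-1 * l <= l ^+ 2 by rewrite expr2 ler_wpM2r// ltW.
have b0 : 0 <= (1 + 2 * l) / (2 * l ^+ 2) by rewrite divr_ge0 ?mulr_ge0//; lra.
by rewrite (ger0_norm b0) ler_pdivrMr ?mulr_gt0//; lra.
Qed.

(** In units of [sqrt t], averaging [Phi] over a centred step of variance [v]
    adds [v / (2 t) Phi''], and so does, to first order in [v / t], the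
    increase of the variance from [t] to [t + v].  The coefficient of [v^2]
    collects the second-order terms of both [Phi (l y)] in [l] and [l] in
    [v / t]. *)
Lemma heat_step (I : eqType) (r : seq I) (w x : I -> R) (v B : R) :
  {in r, forall i, 0 <= w i} -> {in r, forall i, `|x i| <= B} -> 0 <= v ->
  \sum_(i <- r) w i = 1 -> \sum_(i <- r) w i * x i = 0 ->
  \sum_(i <- r) w i * x i ^+ 2 = v ->
  forall t z, 1 <= t -> v <= t ->
  `|\sum_(i <- r) w i * Phi ((z - x i) / Num.sqrt t) - Phi (z / Num.sqrt (t + v))|
     <= (4 * B ^+ 3 + 70 * v ^+ 2) / Num.sqrt t ^+ 3.
Proof.
move=> w0 xB v0 w1 wx wx2 t z t1 vt; subst v; set v := \sum_(i <- r) w i * x i ^+ 2 in v0 vt *.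
have t0 : 0 < t by lra.
set q := Num.sqrt t; set l := q / Num.sqrt (t + v); set y := z / q.
have q0 : 0 < q by rewrite sqrtr_gt0.
have q1 : 1 <= q by rewrite -sqrtr1 ler_wsqrtr.
have qt : q ^+ 2 = t by rewrite sqr_sqrtr// ltW.
have -> : z / Num.sqrt (t + v) = l * y by rewrite /l /y; field; rewrite !gt_eqF// sqrtr_gt0; lra.
have vt' : 0 <= v <= t by rewrite v0 vt.
have := sqrt_ratio_expansion t1 vt'; rewrite -/q -/l; clearbody l => -[lh [l1 l2]].
have H1 := normal_cdf_scale y lh.
have H2 : `|\sum_(i <- r) w i * Phi ((z - x i) / q) - (Phi y + v / (2 * t) * (- y * phi y))|
    <= 4 * B ^+ 3 / q ^+ 3.
  have -> : Phi y + v / (2 * t) * (- y * phi y) = \sum_(i <- r) w i *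
      (Phi y + (- x i / q) * phi y + (- x i / q) ^+ 2 / 2 * (- y * phi y)).
    under eq_bigr => i _.
      have -> : w i * (Phi y + - x i / q * phi y + (- x i / q) ^+ 2 / 2 * (- y * phi y)) =
        w i * Phi y + (w i * x i) * (- phi y / q) + (w i * x i ^+ 2) * ((- y * phi y) / (2 * t)).
        by rewrite -qt; field; rewrite gt_eqF.
      over.
    rewrite !big_split /= -!mulr_suml w1 wx -/v; ring.
  rewrite -sumrB; apply: le_trans (ler_norm_sum _ _ _) _.
  have -> : 4 * B ^+ 3 / q ^+ 3 = \sum_(i <- r) w i * (4 * B ^+ 3 / q ^+ 3).
    by rewrite -mulr_suml w1 mul1r.
  rewrite !big_seq; apply: ler_sum => i ir.
  rewrite -mulrBr normrM (ger0_norm (w0 _ ir)) ler_wpM2l ?w0//.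
  have -> : (z - x i) / q = y + - x i / q by rewrite /y mulrDl.
  apply: le_trans (normal_cdf_taylor3 _ _) _.
  rewrite normrM normrN normfV (ger0_norm (ltW q0)) exprMn exprVn mulrA.
  rewrite ler_wpM2r ?invr_ge0 ?exprn_ge0 ?(ltW q0)// ler_wpM2l//.
  by rewrite lerXn2r ?nnegrE// (le_trans _ (xB _ ir)) ?xB.
have H3 : v ^+ 2 / t ^+ 2 <= v ^+ 2 / q ^+ 3.
  rewrite ler_wpM2l ?sqr_ge0// lef_pV2 ?posrE ?exprn_gt0//.
  by rewrite -qt -exprM ler_weXn2l.
have H4 : `|(1 - l - v / (2 * t)) * (- y * phi y)| <= 6 * (l - 1) ^+ 2.
  rewrite normrM -[leRHS]mulr1 ler_pM//; exact: normal_pdf_derive_le.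
move: H1 H2 H4; set T := \sum_(i <- r) _; set D := - y * phi y.
have -> : y * phi y = - D by rewrite /D; ring.
rewrite [X in _ -> _ -> _ -> _ <= X]mulrDl -[70 * _ / _]mulrA; set X := 4 * _ / _ => H1 H2 H4.
have -> : T - Phi (l * y) = (T - (Phi y + v / (2 * t) * D)) -
    (Phi (l * y) - (Phi y + (l - 1) * - D)) - (1 - l - v / (2 * t)) * D by ring.
apply: le_trans (ler_normB _ _) _; apply: le_trans (lerD (ler_normB _ _) H4) _.
by have := lerD H2 H1; lra.
Qed.

End GaussianTaylor.

(** * Comparison of the walk with the heat flow *)

Section WalkComparison.
Variables (R : realType) (S : {fset int}) (p : int -> R).
Hypothesis p_gt0 : forall s, s \in S -> 0 < p s.
Hypothesis P1 : 0 < step_poly S p 1.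

Local Notation Phi := (@normal_cdf R).
Local Notation stay := (stay_prob S p).

Definition step_prob (s : int) : R := p s / step_poly S p 1.
Local Notation pr := step_prob.

Lemma step_prob_ge0 s : s \in S -> 0 <= pr s.
Proof. by move=> sS; rewrite divr_ge0 ?ltW ?p_gt0. Qed.

Lemma sum_step_prob : \sum_(s <- S) pr s = 1.
Proof. by rewrite -mulr_suml -step_poly1 divff// gt_eqF. Qed.

Lemma stayS n y : 0 <= y -> stay n.+1 y = \sum_(s <- S) pr s * stay n (y - s%:~R).
Proof. by rewrite /= leNgt => /negbTE ->. Qed.

Lemma stay_lt0 n y : y < 0 -> stay n y = 0.
Proof. by case: n => [|n] /= ->. Qed.

Lemma stay_bounds n y : 0 <= stay n y <= 1.
Proof.
elim: n y => [|n IH] y; first by rewrite /=; case: ifP; rewrite ?lexx ?ler01.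
have [y0|y0] := ltP y 0; first by rewrite stay_lt0// lexx ler01.
have IH0 s : 0 <= stay n (y - s%:~R) by case/andP: (IH (y - s%:~R)).
have IH1 s : stay n (y - s%:~R) <= 1 by case/andP: (IH (y - s%:~R)).
rewrite stayS//; apply/andP; split.
  by rewrite big_seq; apply: sumr_ge0 => s sS; rewrite mulr_ge0 ?step_prob_ge0.
rewrite -[leRHS]sum_step_prob !big_seq; apply: ler_sum => s sS.
by rewrite ler_piMr ?step_prob_ge0.
Qed.

(** Comparison principle: a function which satisfies the recursion up to [E]
    from above dominates, up to [n E], the solution [c * stay_prob]. Only
    levels above [- D] matter because no step exceeds [D]. *)
Lemma stay_le (G : nat -> R -> R) (E c D : R) : 0 <= E ->
  {in S, forall s, s%:~R <= D} ->
  (forall m y, - D <= y -> y < 0 -> 0 <= G m y) ->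
  (forall y, 0 <= y -> c <= G 0%N y) ->
  (forall m y, 0 <= y -> \sum_(s <- S) pr s * G m (y - s%:~R) <= G m.+1 y + E) ->
  forall m y, - D <= y -> c * stay m y <= G m y + m%:R * E.
Proof.
move=> E0 SD Gneg G0 GS; elim=> [|m IH] y yD.
  rewrite mul0r addr0; have [y0|y0] := ltP y 0.
    by rewrite stay_lt0// mulr0 Gneg.
  by rewrite /= ltNge y0 /= mulr1 G0.
have [y0|y0] := ltP y 0.
  by rewrite stay_lt0// mulr0 addr_ge0 ?Gneg// mulr_ge0.
rewrite stayS// mulr_sumr.
have H : \sum_(s <- S) c * (pr s * stay m (y - s%:~R)) <=
    \sum_(s <- S) pr s * (G m (y - s%:~R) + m%:R * E).
  rewrite !big_seq; apply: ler_sum => s sS; rewrite mulrCA ler_wpM2l ?step_prob_ge0//.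
  by apply: IH; have := SD s sS; lra.
apply: le_trans H _.
under eq_bigr do rewrite mulrDr.
rewrite big_split /= -mulr_suml sum_step_prob mul1r -natr1 mulrDl mul1r.
by have := GS m y y0; lra.
Qed.

(** The dual comparison principle.  Being nonpositive below the boundary is
    enough, since the solution vanishes there. *)
Lemma stay_ge (G : nat -> R -> R) (E : R) : 0 <= E ->
  (forall m y, y < 0 -> G m y <= 0) ->
  (forall y, G 0%N y <= 1) ->
  (forall m y, 0 <= y -> G m.+1 y <= \sum_(s <- S) pr s * G m (y - s%:~R) + E) ->
  forall m y, G m y <= stay m y + m%:R * E.
Proof.
move=> E0 Gneg G0 GS; elim=> [|m IH] y.
  rewrite mul0r addr0; have [y0|y0] := ltP y 0.
    by rewrite stay_lt0// Gneg.
  by rewrite /= ltNge y0 /= G0.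
have [y0|y0] := ltP y 0.
  by rewrite stay_lt0// add0r (le_trans (Gneg _ _ y0))// mulr_ge0.
rewrite stayS//.
have H : \sum_(s <- S) pr s * G m (y - s%:~R) <=
    \sum_(s <- S) pr s * (stay m (y - s%:~R) + m%:R * E).
  by rewrite !big_seq; apply: ler_sum => s sS; rewrite ler_wpM2l ?step_prob_ge0.
apply: le_trans (GS _ _ y0) _; move: H.
under [X in _ <= X -> _]eq_bigr do rewrite mulrDr.
rewrite big_split /= -mulr_suml sum_step_prob mul1r -natr1 mulrDl mul1r; lra.
Qed.

Variables (mu v : R).
Hypothesis mean : \sum_(s <- S) pr s * s%:~R = mu.
Hypothesis variance : \sum_(s <- S) pr s * (s%:~R - mu) ^+ 2 = v.
Hypothesis v_gt0 : 0 < v.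

Lemma seq_ub (I : eqType) (r : seq I) (f : I -> R) :
  exists2 B, 0 <= B & {in r, forall i, f i <= B}.
Proof.
elim: r => [|i r [B B0 HB]]; first by exists 0.
exists (Num.max B (f i)); first by rewrite le_max B0.
by move=> j; rewrite inE le_max => /orP[/eqP->|/HB->]; rewrite ?lexx ?orbT.
Qed.

(** The heat flow with drift, started [beta] time units before 0 so that it is
    smooth at time 0, with the origin shifted by [alpha]. *)
Definition heat_sol (alpha beta : R) (m : nat) (y : R) : R :=
  Phi ((y - mu * m%:R + alpha) / Num.sqrt (v * (m%:R + beta))).

Lemma heat_sol_step : exists2 K : R, 0 <= K & forall alpha beta m y,
  1 <= beta -> 1 <= v * beta ->
  `|\sum_(s <- S) pr s * heat_sol alpha beta m (y - s%:~R) - heat_sol alpha beta m.+1 y|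
    <= K / Num.sqrt (v * beta) ^+ 3.
Proof.
have [B B0 HB] := @seq_ub _ S (fun s => `|s%:~R - mu|).
exists (4 * B ^+ 3 + 70 * v ^+ 2).
  by rewrite addr_ge0// mulr_ge0 ?exprn_ge0// ltW.
move=> alpha beta m y b1 vb1.
have c0 : \sum_(s <- S) pr s * (s%:~R - mu) = 0.
  under eq_bigr do rewrite mulrBr.
  by rewrite sumrB -mulr_suml sum_step_prob mean mul1r subrr.
have vm : v * beta <= v * (m%:R + beta) by rewrite ler_pM2l// lerDr.
have t1 : 1 <= v * (m%:R + beta) by apply: le_trans vm.
have t2 : v <= v * (m%:R + beta) by rewrite ler_peMr ?(ltW v_gt0)// (le_trans b1)// lerDr.
have := heat_step step_prob_ge0 HB (ltW v_gt0) sum_step_prob c0 variance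
  (y - mu * m.+1%:R + alpha) t1 t2.
rewrite /heat_sol.
have -> : v * (m%:R + beta) + v = v * (m.+1%:R + beta) by rewrite -natr1; ring.
under eq_bigr => s _.
  have -> : y - mu * m.+1%:R + alpha - (s%:~R - mu) = y - s%:~R - mu * m%:R + alpha.
    by rewrite -natr1; ring.
  over.
move=> /le_trans; apply; rewrite ler_wpM2l//.
  by rewrite addr_ge0// mulr_ge0 ?exprn_ge0// ltW.
have s0 : 0 < Num.sqrt (v * beta) by rewrite sqrtr_gt0 (lt_le_trans ltr01).
rewrite lef_pV2 ?posrE ?exprn_gt0//; last by rewrite sqrtr_gt0 (lt_le_trans ltr01).
by rewrite lerXn2r ?nnegrE ?sqrtr_ge0 ?ler_wsqrtr.
Qed.

(** The sixteenth root makes all the scales in the choice of [alpha] and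
    [beta] integral powers of one quantity. *)
Definition root16 (n : nat) : R := Num.sqrt (Num.sqrt (Num.sqrt (Num.sqrt n%:R))).

Lemma root16_pow8 n : root16 n ^+ 8 = Num.sqrt n%:R.
Proof. by rewrite /root16 (exprM _ 2 4) sqr_sqrtr// (exprM _ 2 2) sqr_sqrtr// sqr_sqrtr. Qed.

Lemma root16_pow16 n : root16 n ^+ 16 = n%:R.
Proof. by rewrite (exprM _ 8 2) root16_pow8 sqr_sqrtr. Qed.

Lemma root16_cvgy : root16 n @[n --> \oo] --> +oo.
Proof.
apply/cvgryPge => M; near=> n.
have [M0|M0] := leP M 0; first by rewrite (le_trans M0) ?sqrtr_ge0.
rewrite -(@ler_pXn2r _ 16) ?nnegrE ?sqrtr_ge0 ?(ltW M0)// root16_pow16.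
by near: n; apply: nbhs_infty_ger.
Unshelve. all: by end_near. Qed.

Lemma root16_ge M : \forall n \near \oo, M <= root16 n.
Proof. by move/cvgryPge : root16_cvgy; apply. Qed.

Lemma inv_root16_cvg0 : (root16 n)^-1 @[n --> \oo] --> (0 : R).
Proof.
apply: (proj2 (gtr0_cvgV0 _) root16_cvgy); near=> n.
by apply: lt_le_trans ltr01 _; near: n; exact: root16_ge.
Unshelve. all: by end_near. Qed.

Lemma normal_cdf_continuous : continuous Phi.
Proof.
move=> x; apply/differentiable_continuous/derivable1_diffP.
by case: (is_derive_normal_cdf x).
Qed.

Lemma tail_cvg0 : 1 - Phi (root16 n) @[n --> \oo] --> (0 : R).
Proof.
rewrite -[0](subrr 1); apply: cvgB; first exact: cvg_cst.
exact: cvg_comp root16_cvgy (@normal_cdf_cvgy R).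
Qed.

Lemma limit_value_cvg (x e : R) :
  Phi ((x + e / root16 n) / Num.sqrt (1 + (root16 n)^-1 ^+ 4)) @[n --> \oo] --> Phi x.
Proof.
have cs := inv_root16_cvg0.
apply: continuous_cvg; first exact: normal_cdf_continuous.
have E : (x + e * 0) / Num.sqrt (1 + 0 ^+ 4) = x.
  by rewrite mulr0 addr0 expr0n addr0 sqrtr1 divr1.
rewrite -[X in _ --> X]E; apply: cvgM.
  by apply: cvgD; [exact: cvg_cst|apply: cvgM => //; exact: cvg_cst].
apply: cvgV; first by rewrite expr0n addr0 sqrtr1 oner_neq0.
apply: continuous_cvg; first exact: sqrt_continuous.
apply: cvgD; first exact: cvg_cst.
exact: continuous_cvg (@exprn_continuous _ 4 0) cs.
Qed.

(** At time [n] and at the level [mu n + x sqrt (v n)] the perturbations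
    [alpha] and [beta] only remain as terms which vanish with [n]. *)
Lemma heat_sol_end (x e : R) n : (0 < n)%N ->
  heat_sol (e * Num.sqrt v * root16 n ^+ 7) (root16 n ^+ 12) n
    (mu * n%:R + x * (Num.sqrt v * Num.sqrt n%:R)) =
  Phi ((x + e / root16 n) / Num.sqrt (1 + (root16 n)^-1 ^+ 4)).
Proof.
move=> n0; rewrite /heat_sol -root16_pow8 -root16_pow16; set a := root16 n.
have a0 : 0 < a by rewrite !sqrtr_gt0 ltr0n.
congr (Phi _).
have -> : v * (a ^+ 16 + a ^+ 12) = (Num.sqrt v * a ^+ 8) ^+ 2 * (1 + a^-1 ^+ 4).
  by rewrite exprMn sqr_sqrtr ?(ltW v_gt0)//; field; rewrite gt_eqF.
have v0 : 0 < Num.sqrt v by rewrite sqrtr_gt0.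
rewrite sqrtrM ?sqr_ge0// sqrtr_sqr ger0_norm ?mulr_ge0 ?exprn_ge0 ?ltW//.
have s0 : 0 < Num.sqrt (1 + a^-1 ^+ 4).
  by rewrite sqrtr_gt0 ltr_wpDr// exprn_ge0// invr_ge0 ltW.
by field; rewrite !gt_eqF.
Qed.

(** The accumulated error: [n = A^16] errors of order [A^(-18)]. *)
Lemma heat_error (K : R) n : (0 < n)%N ->
  n%:R * (K / Num.sqrt (v * root16 n ^+ 12) ^+ 3) = K / Num.sqrt v ^+ 3 * (root16 n)^-1 ^+ 2.
Proof.
move=> n0; rewrite -root16_pow16; set a := root16 n.
have a0 : 0 < a by rewrite !sqrtr_gt0 ltr0n.
have v0 : 0 < Num.sqrt v by rewrite sqrtr_gt0.
have -> : v * a ^+ 12 = (Num.sqrt v * a ^+ 6) ^+ 2.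
  by rewrite exprMn sqr_sqrtr ?(ltW v_gt0)//; ring.
rewrite sqrtr_sqr ger0_norm ?mulr_ge0 ?exprn_ge0 ?ltW//.
by field; rewrite !gt_eqF.
Qed.

Lemma error_cvg0 (C : R) : C * (root16 n)^-1 ^+ 2 @[n --> \oo] --> (0 : R).
Proof.
rewrite -(mulr0 C); apply: cvgM; first exact: cvg_cst.
rewrite -[X in _ --> X](expr0n R 2).
exact: continuous_cvg (@exprn_continuous _ 2 0) inv_root16_cvg0.
Qed.

Lemma root16_beta_ge1 : \forall n \near \oo,
  [/\ (0 < n)%N, 1 <= root16 n, 1 <= root16 n ^+ 12 & 1 <= v * root16 n ^+ 12].
Proof.
near=> n.
have s1 : 1 <= root16 n by near: n; exact: root16_ge.
have s12 : root16 n <= root16 n ^+ 12 by rewrite -[leLHS]expr1 ler_weXn2l.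
split=> //; first by near: n; exact: nbhs_infty_gt.
  exact: le_trans s12.
rewrite -ler_pdivrMl// mulr1; apply: le_trans s12; near: n; exact: root16_ge.
Unshelve. all: by end_near. Qed.

Let far n := Num.sqrt v * root16 n ^+ 7.

Lemma far_ge M : 0 <= M -> \forall n \near \oo, M <= far n.
Proof.
move=> M0; near=> n.
have v0 : 0 < Num.sqrt v by rewrite sqrtr_gt0.
have s1 : 1 <= root16 n by near: n; exact: root16_ge.
have s7 : root16 n <= root16 n ^+ 7 by rewrite -[leLHS]expr1 ler_weXn2l.
rewrite /far -ler_pdivrMl//; apply: le_trans s7; near: n; exact: root16_ge.
Unshelve. all: by end_near. Qed.

(** The shift [alpha] is [A] times the width [sqrt (v beta)] of the initial
    layer, so that the initial value is as close to an indicator as [Phi A]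
    is to 1. *)
Lemma far_ratio n : 0 < root16 n -> far n / Num.sqrt (v * root16 n ^+ 12) = root16 n.
Proof.
move=> a0; have v0 : 0 < Num.sqrt v by rewrite sqrtr_gt0.
have -> : v * root16 n ^+ 12 = (Num.sqrt v * root16 n ^+ 6) ^+ 2.
  by rewrite exprMn sqr_sqrtr ?(ltW v_gt0)//; ring.
rewrite sqrtr_sqr ger0_norm ?mulr_ge0 ?exprn_ge0 ?ltW// /far.
by field; rewrite !gt_eqF.
Qed.

Lemma heat_sol0_ge n y : 0 < root16 n -> 0 <= y ->
  Phi (root16 n) <= heat_sol (far n) (root16 n ^+ 12) 0 y.
Proof.
move=> a0 y0; apply: normal_cdf_le; rewrite -[leLHS]far_ratio// mulr0 subr0 add0r.
by rewrite ler_wpM2r ?invr_ge0 ?sqrtr_ge0// lerDr.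
Qed.

(** Below the boundary the argument of [Phi] is less than
    [- (alpha + mu m) / sqrt (v (m + beta))].  The square of the numerator
    is at least [alpha^2 + 2 alpha mu m]; the first term beats [A^2 v beta]
    and, thanks to the drift, the second one beats [A^2 v m]. *)
Lemma heat_sol_neg_le n m y : 0 < mu -> 0 < root16 n -> v * root16 n ^+ 2 <= 2 * far n * mu ->
  y < 0 -> heat_sol (- far n) (root16 n ^+ 12) m y <= 1 - Phi (root16 n).
Proof.
move=> mu0 a0 vmu y0; rewrite -normal_cdfN; apply: normal_cdf_le.
set t := v * (m%:R + root16 n ^+ 12).
have t0 : 0 < t by rewrite mulr_gt0// ltr_wpDl// exprn_gt0.
have F0 : 0 < far n by rewrite mulr_gt0 ?sqrtr_gt0 ?exprn_gt0.
rewrite -/t ler_pdivrMr ?sqrtr_gt0// mulNr lerNr.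
apply: (@le_trans _ _ (far n + mu * m%:R)); last by lra.
have l0 : 0 <= root16 n * Num.sqrt t by rewrite mulr_ge0 ?sqrtr_ge0// ltW.
have r0 : 0 <= far n + mu * m%:R.
  by apply: addr_ge0; rewrite ?(ltW F0)// mulr_ge0// ltW.
rewrite -(@ler_pXn2r _ 2) ?nnegrE// exprMn [Num.sqrt t ^+ 2]sqr_sqrtr ?(ltW t0)//.
have F2 : far n ^+ 2 = v * root16 n ^+ 14.
  by rewrite /far exprMn sqr_sqrtr ?(ltW v_gt0)// -exprM.
have -> : root16 n ^+ 2 * t = v * root16 n ^+ 14 + (v * root16 n ^+ 2) * m%:R by rewrite /t; ring.
have := ler_wpM2r (ler0n R m) vmu; have := sqr_ge0 (mu * m%:R).
by rewrite sqrrD F2; lra.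
Qed.

(** For the upper bound the shift is [+ alpha], which makes the initial value
    large enough; for the lower bound it is [- alpha], and the supremum
    [1 - Phi A] of the flow below the boundary is subtracted. *)
Lemma stay_cvg_normal (x : R) : 0 < mu ->
  stay n (mu * n%:R + x * (Num.sqrt v * Num.sqrt n%:R)) @[n --> \oo] --> Phi x.
Proof.
move=> mu0; have [K K0 HK] := heat_sol_step.
pose err n := K / Num.sqrt v ^+ 3 * (root16 n)^-1 ^+ 2 + (1 - Phi (root16 n)).
pose val e n := Phi ((x + e / root16 n) / Num.sqrt (1 + (root16 n)^-1 ^+ 4)).
have err0 : err n @[n --> \oo] --> (0 : R).
  by rewrite -[X in _ --> X]addr0; apply: cvgD; [exact: error_cvg0|exact: tail_cvg0].
have val_cvg e : val e n @[n --> \oo] --> Phi x by exact: limit_value_cvg.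
apply: (@squeeze_cvgr _ _ _ _ (fun n => val (-1) n - err n) (fun n => val 1 n + err n)).
- near=> n.
  have [n0 a1 b1 vb1] : [/\ (0 < n)%N, 1 <= root16 n, 1 <= root16 n ^+ 12 &
    1 <= v * root16 n ^+ 12] by near: n; exact: root16_beta_ge1.
  have a0 : 0 < root16 n by apply: lt_le_trans a1.
  set y := mu * n%:R + x * _; set E := K / Num.sqrt (v * root16 n ^+ 12) ^+ 3.
  have E0 : 0 <= E by rewrite divr_ge0// exprn_ge0 ?sqrtr_ge0.
  have nE : n%:R * E = K / Num.sqrt v ^+ 3 * (root16 n)^-1 ^+ 2 by exact: heat_error.
  have /andP[st0 st1] := stay_bounds n y.
  apply/andP; split.
    have := @stay_ge
      (fun m y => heat_sol (- far n) (root16 n ^+ 12) m y - (1 - Phi (root16 n))) E E0.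
    have vmu : v * root16 n ^+ 2 <= 2 * far n * mu.
      rewrite /far -mulrA; set w := Num.sqrt v.
      have w0 : 0 < w by rewrite sqrtr_gt0.
      have -> : v = w ^+ 2 by rewrite sqr_sqrtr// ltW.
      have -> : 2 * (w * root16 n ^+ 7 * mu) = w * root16 n ^+ 2 * (2 * mu * root16 n ^+ 5) by ring.
      have -> : w ^+ 2 * root16 n ^+ 2 = w * root16 n ^+ 2 * w by ring.
      rewrite ler_pM2l ?mulr_gt0 ?exprn_gt0// -ler_pdivrMl ?mulr_gt0//.
      apply: (@le_trans _ _ (root16 n)); first by near: n; exact: root16_ge.
      by rewrite -[leLHS]expr1 ler_weXn2l.
    have <- : heat_sol (- far n) (root16 n ^+ 12) n y = val (-1) n.
      by rewrite /val -heat_sol_end// mulN1r mulNr.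
    move=> /(_ _ _ _ n y) H; rewrite /err -nE.
    suff : heat_sol (- far n) (root16 n ^+ 12) n y - (1 - Phi (root16 n)) <= stay n y + n%:R * E.
      by lra.
    apply: H => [m z z0|z|m z z0].
    + by rewrite subr_le0; apply: heat_sol_neg_le.
    + have := normal_cdf_le1 (root16 n).
      have := normal_cdf_le1 ((z - mu * 0%:R + - far n) / Num.sqrt (v * (0%:R + root16 n ^+ 12))).
      by rewrite /heat_sol; lra.
    + under eq_bigr do rewrite mulrBr.
      rewrite sumrB -mulr_suml sum_step_prob mul1r.
      have := HK (- far n) _ m z b1 vb1; rewrite -/E ler_norml => /andP[+ _].
      lra.
  have <- : heat_sol (far n) (root16 n ^+ 12) n y = val 1 n.
    by rewrite /val -heat_sol_end// mul1r.
  have [D D0 SD] := @seq_ub _ S (fun s => s%:~R).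
  have := @stay_le (heat_sol (far n) (root16 n ^+ 12)) E (Phi (root16 n)) (Num.max D `|y|) E0.
  have yD : - Num.max D `|y| <= y.
    by rewrite lerNl le_max; apply/orP; right; rewrite -normrN ler_norm.
  move=> /(_ _ _ _ _ n y yD) H.
  have : Phi (root16 n) * stay n y <= heat_sol (far n) (root16 n ^+ 12) n y + n%:R * E.
    apply: H => [s sS|m z _ _|z z0|m z z0].
    + by rewrite le_max SD.
    + exact: normal_cdf_ge0.
    + exact: heat_sol0_ge.
    + have := HK (far n) _ m z b1 vb1; rewrite -/E ler_norml => /andP[_].
      lra.
  have := normal_cdf_le1 (root16 n); rewrite /err -nE => f1 H1.
  have : (1 - Phi (root16 n)) * stay n y <= 1 - Phi (root16 n) by rewrite ler_piMr// subr_ge0.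
  lra.
- by rewrite -[X in _ --> X]subr0; apply: cvgB.
- by rewrite -[X in _ --> X]addr0; apply: cvgD.
Unshelve. all: by end_near. Qed.

(** The flow [2 Phi - 1] is odd in the space variable.  Without shift it is
    nonpositive below the boundary, which gives the lower bound; shifted by
    [alpha >= D] it is nonnegative on the levels [y >= - D] which a walk can
    reach when it leaves the half-line, which gives the upper bound. *)
Lemma stay_cvg_half_normal (x : R) : mu = 0 -> 0 <= x ->
  stay n (x * (Num.sqrt v * Num.sqrt n%:R)) @[n --> \oo] --> 2 * Phi x - 1.
Proof.
move=> mu0 x0; have [K K0 HK] := heat_sol_step.
pose err n := 2 * (K / Num.sqrt v ^+ 3 * (root16 n)^-1 ^+ 2 + (1 - Phi (root16 n))).
pose val e n := 2 * Phi ((x + e / root16 n) / Num.sqrt (1 + (root16 n)^-1 ^+ 4)) - 1.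
have err0 : err n @[n --> \oo] --> (0 : R).
  rewrite -[X in _ --> X](mulr0 2); apply: cvgM; first exact: cvg_cst.
  by rewrite -[X in _ --> X]addr0; apply: cvgD; [exact: error_cvg0|exact: tail_cvg0].
have val_cvg e : val e n @[n --> \oo] --> 2 * Phi x - 1.
  apply: cvgB; last exact: cvg_cst.
  by apply: cvgM; [exact: cvg_cst|exact: limit_value_cvg].
have [D D0 SD] := @seq_ub _ S (fun s => s%:~R).
apply: (@squeeze_cvgr _ _ _ _ (fun n => val 0 n - err n) (fun n => val 1 n + err n)).
- near=> n.
  have [n0 a1 b1 vb1] : [/\ (0 < n)%N, 1 <= root16 n, 1 <= root16 n ^+ 12 &
    1 <= v * root16 n ^+ 12] by near: n; exact: root16_beta_ge1.
  have a0 : 0 < root16 n by apply: lt_le_trans a1.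
  set y := x * _; set E := K / Num.sqrt (v * root16 n ^+ 12) ^+ 3.
  have y0 : 0 <= y by rewrite !mulr_ge0 ?sqrtr_ge0.
  have E0 : 0 <= E by rewrite divr_ge0// exprn_ge0 ?sqrtr_ge0.
  have nE : n%:R * E = K / Num.sqrt v ^+ 3 * (root16 n)^-1 ^+ 2 by exact: heat_error.
  have E20 : 0 <= 2 * E by rewrite mulr_ge0.
  have /andP[st0 st1] := stay_bounds n y.
  have f1 := normal_cdf_le1 (root16 n).
  have yE : y = mu * n%:R + y by rewrite mu0 mul0r add0r.
  have odd_step alpha m z :
    `|\sum_(s <- S) pr s * (2 * heat_sol alpha (root16 n ^+ 12) m (z - s%:~R) - 1) -
      (2 * heat_sol alpha (root16 n ^+ 12) m.+1 z - 1)| <= 2 * E.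
    under eq_bigr do rewrite mulrBr mulr1 mulrCA.
    rewrite sumrB -mulr_sumr sum_step_prob.
    set A := \sum_(s <- S) _.
    have -> : 2 * A - 1 - (2 * heat_sol alpha (root16 n ^+ 12) m.+1 z - 1) =
      2 * (A - heat_sol alpha (root16 n ^+ 12) m.+1 z) by ring.
    by rewrite normrM ger0_norm// ler_wpM2l// HK.
  have half_le alpha m z : z + alpha <= 0 -> heat_sol alpha (root16 n ^+ 12) m z <= 2^-1.
    move=> za; rewrite -normal_cdf0; apply: normal_cdf_le.
    by rewrite mu0 mul0r subr0 pmulr_lle0 ?invr_gt0 ?sqrtr_gt0// mulr_gt0// ltr_wpDl// exprn_gt0.
  have half_ge alpha m z : 0 <= z + alpha -> 2^-1 <= heat_sol alpha (root16 n ^+ 12) m z.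
    move=> za; rewrite -normal_cdf0; apply: normal_cdf_le.
    by rewrite mu0 mul0r subr0 mulr_ge0// invr_ge0 sqrtr_ge0.
  apply/andP; split.
    have <- : 2 * heat_sol 0 (root16 n ^+ 12) n y - 1 = val 0 n.
      by rewrite /val -heat_sol_end// !mul0r -yE.
    have H : 2 * heat_sol 0 (root16 n ^+ 12) n y - 1 <= stay n y + n%:R * (2 * E).
      apply: (@stay_ge (fun m z => 2 * heat_sol 0 (root16 n ^+ 12) m z - 1)) => // [m z z0|z|m z z0].
      + by have := half_le 0 m z; rewrite addr0 => /(_ (ltW z0)); lra.
      + have := normal_cdf_le1 ((z - mu * 0%:R + 0) / Num.sqrt (v * (0%:R + root16 n ^+ 12))).
        by rewrite /heat_sol; lra.
      + by have := odd_step 0 m z; rewrite ler_norml => /andP[+ _]; lra.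
    by rewrite /err -nE; lra.
  have <- : 2 * heat_sol (far n) (root16 n ^+ 12) n y - 1 = val 1 n.
    by rewrite /val -heat_sol_end// mul1r -yE.
  have Df : D <= far n by near: n; exact: far_ge.
  have H : (2 * Phi (root16 n) - 1) * stay n y <=
      2 * heat_sol (far n) (root16 n ^+ 12) n y - 1 + n%:R * (2 * E).
    apply: (@stay_le (fun m z => 2 * heat_sol (far n) (root16 n ^+ 12) m z - 1) _ _ D) => //
      [m z zD z0|z z0|m z z0|].
    + have zf : 0 <= z + far n by lra.
      by have := half_ge _ m _ zf; lra.
    + by have := heat_sol0_ge a0 z0; lra.
    + by have := odd_step (far n) m z; rewrite ler_norml => /andP[_]; lra.
    + lra.
  have : 2 * (1 - Phi (root16 n)) * stay n y <= 2 * (1 - Phi (root16 n)).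
    by rewrite ler_piMr// mulr_ge0// subr_ge0.
  by rewrite /err -nE; lra.
- by rewrite -[X in _ --> X]subr0; apply: cvgB.
- by rewrite -[X in _ --> X]addr0; apply: cvgD.
Unshelve. all: by end_near. Qed.

End WalkComparison.

(** * The limit laws for zero and positive drift *)

Section HalfNormal.
Variable R : realType.
Local Notation Phi := (@normal_cdf R).

(** The right-hand side is the derivative of [2 Phi (0 + x / sigma)] in the
    form in which the chain rule along a line produces it. *)
Lemma half_normal_pdfE (sigma x : R) : 0 < sigma -> 0 <= x ->
  half_normal_pdf sigma x = 2 * (normal_pdf 0 1 (0 + x * sigma^-1) * sigma^-1).
Proof.
move=> s0 x0; rewrite /half_normal_pdf x0 normal_pdf01E add0r.
have pi0 := pi_gt0 R.
have p0 := @normal_peak_gt0 R 1 (oner_neq0 _).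
have p2 : normal_peak (1:R) ^+ 2 = (pi *+ 2)^-1.
  by rewrite /normal_peak exprVn sqr_sqrtr expr1n mul1r// mulrn_wge0// ltW.
move: (pi : R) pi0 p2 => q q0 p2.
have -> : 2 / (q * sigma ^+ 2) = (2 / sigma * normal_peak 1) ^+ 2.
  by rewrite exprMn p2 -mulr_natr; field; rewrite !gt_eqF.
have b0 : 0 <= 2 / sigma * normal_peak 1 by rewrite mulr_ge0 ?divr_ge0 ?(ltW s0) ?(ltW p0).
rewrite sqrtr_sqr (ger0_norm b0).
have -> : x ^+ 2 / (2 * sigma ^+ 2) = (x / sigma) ^+ 2 / 2.
  by field; rewrite gt_eqF.
by set e := expR _; field; rewrite gt_eqF.
Qed.

Lemma half_normal_cdf (sigma x : R) : 0 < sigma ->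
  fine (half_normal sigma `]-oo, x]%classic) =
  if x < 0 then 0 else 2 * Phi (x / sigma) - 1.
Proof.
move=> s0; rewrite /half_normal.
have -> : (\int[lebesgue_measure]_(y in `]-oo, x]) (half_normal_pdf sigma y)%:E =
    \int[lebesgue_measure]_(y in `[0%R, x]) (half_normal_pdf sigma y)%:E)%E.
  rewrite integral_mkcond [RHS]integral_mkcond; congr (integral _ _ _).
  apply/funext => y; rewrite !patchE !mem_setE !in_itv /= /half_normal_pdf.
  by case: (leP 0 y) => //= _; case: ifP.
case: ltP => x0.
  by rewrite set_itv_ge ?integral_set0// bnd_simp -ltNge.
have [->|xn0] := eqVneq x 0.
  by rewrite set_itv1 integral_set1 mul0r normal_cdf0 divff// subrr.
have {xn0}x0 : 0 < x by rewrite lt_neqAle eq_sym xn0.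
pose F y : R := 2 * Phi (0 + y * sigma^-1).
pose f y : R := 2 * (normal_pdf 0 1 (0 + y * sigma^-1) * sigma^-1).
have dF (y : R) : is_derive y 1 F (f y).
  exact: is_deriveZ (is_derive_line (is_derive_normal_cdf _)).
have cF : continuous F.
  by move=> y; apply/differentiable_continuous/derivable1_diffP; case: (dF y).
have cf : continuous f.
  move=> y; apply: cvgM; first exact: cvg_cst.
  apply: cvgM; last exact: cvg_cst.
  apply: continuous_cvg; first by apply: continuous_normal_pdf; rewrite oner_neq0.
  by apply: cvgD; [exact: cvg_cst|apply: cvgM => //; exact: cvg_cst].
under eq_integral => y.
  rewrite inE /= in_itv /= => /andP[y0 _]; rewrite half_normal_pdfE// -/(f y); over.
rewrite (@continuous_FTC2 _ f F 0 x)//=.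
- by rewrite /F mul0r !add0r normal_cdf0 divff.
- exact: continuous_subspaceT.
- split=> [y _||]; first by case: (dF y).
    by apply: cvg_at_right_filter; exact: cF.
  by apply: cvg_at_left_filter; exact: cF.
- by move=> y _; rewrite derive1E; apply: derive_val.
Qed.

End HalfNormal.

Section CriticalAndPositiveDrift.
Variables (R : realType) (S : {fset int}) (p : int -> R).
Hypothesis S_neg : exists2 s, s \in S & s < 0.
Hypothesis S_pos : exists2 s, s \in S & 0 < s.
Hypothesis p_gt0 : forall s, s \in S -> 0 < p s.

Let P : R -> R := step_poly S p.
Let P' : R -> R := derive1 P.
Let P'' : R -> R := derive1 P'.
Let mu := P' 1 / P 1.
Let v := P'' 1 / P 1 + P' 1 / P 1 - (P' 1 / P 1) ^+ 2.

Lemma step_poly_gt0 (x : R) : 0 < x -> 0 < step_poly S p x.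
Proof.
move=> x0; have [s0 s0S _] := S_neg.
rewrite /step_poly (big_fsetD1 s0)//= ltr_pwDl//.
  by rewrite mulr_gt0 ?p_gt0 ?exprz_gt0.
rewrite big_seq_cond; apply: sumr_ge0 => s; rewrite !inE andbT => /andP[_ sS].
by rewrite mulr_ge0 ?ltW ?p_gt0 ?exprz_gt0.
Qed.

Let P1 : 0 < step_poly S p 1 := step_poly_gt0 ltr01.

Lemma step_mean : \sum_(s <- S) step_prob S p s * s%:~R = mu.
Proof.
rewrite /mu /P' /P step_poly_derive1// mulr_suml; apply: eq_bigr => s _.
by rewrite exp1rz mulr1 /step_prob mulrAC.
Qed.

Lemma step_variance : \sum_(s <- S) step_prob S p s * (s%:~R - mu) ^+ 2 = v.
Proof.
have E : \sum_(s <- S) step_prob S p s * s%:~R ^+ 2 = P'' 1 / P 1 + mu.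
  rewrite -step_mean /P'' /P' /P step_poly_derive2 mulr_suml -big_split /=.
  by apply: eq_bigr => s _; rewrite /step_prob; ring.
under eq_bigr => s _.
  have -> : step_prob S p s * (s%:~R - mu) ^+ 2 = step_prob S p s * s%:~R ^+ 2 -
    step_prob S p s * s%:~R * (2 * mu) + step_prob S p s * mu ^+ 2 by ring.
  over.
rewrite big_split sumrB /= E -[\sum_(s <- S) _ * (2 * mu)]mulr_suml step_mean.
rewrite -[\sum_(s <- S) _ * mu ^+ 2]mulr_suml (sum_step_prob P1) /v -/mu; ring.
Qed.

(** A positive and a negative step cannot both equal the mean. *)
Lemma step_variance_gt0 : 0 < v.
Proof.
rewrite -step_variance.
have [s0 s0S s0mu] : exists2 s, s \in S & s%:~R != mu.
  have [s0 s0S s0neg] := S_neg; have [s1 s1S s1pos] := S_pos.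
  have [E|] := eqVneq s0%:~R mu; last by exists s0.
  by exists s1 => //; rewrite -E eqr_int gt_eqF// (lt_trans s0neg).
rewrite (big_fsetD1 s0)//= ltr_pwDl//.
  by rewrite mulr_gt0 ?divr_gt0 ?p_gt0// exprn_even_gt0//= subr_eq0.
rewrite big_seq_cond; apply: sumr_ge0 => s; rewrite !inE andbT => /andP[_ sS].
by rewrite mulr_ge0 ?sqr_ge0 ?step_prob_ge0.
Qed.

Lemma walk_cdfE (n : nat) (a b x : R) : 0 < b ->
  walk_cdf p (fun w : n.-tuple S => ((height w)%:~R - a) / b) x = stay_prob S p n (a + x * b).
Proof.
move=> b0; rewrite -walk_prob_height_le//; congr (walk_prob _ _).
by apply/funext => w /=; rewrite ler_pdivrMr// lerBlDl.
Qed.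

Lemma height_cvg_half_normal : P' 1 = 0 ->
  cvg_in_distribution
    (fun n => walk_cdf p (fun w : n.-tuple S => (height w)%:~R / Num.sqrt n%:R))
    (half_normal (Num.sqrt (P'' 1 / P 1))).
Proof.
move=> d0; rewrite /cvg_in_distribution /= => x _.
have mu0 : mu = 0 by rewrite /mu d0 mul0r.
have vE : v = P'' 1 / P 1 by rewrite /v -/mu mu0 expr0n subr0 addr0.
have v0 := step_variance_gt0.
rewrite -vE half_normal_cdf ?sqrtr_gt0//.
case: ltP => x0.
  apply: cvg_near_cst; near=> n; rewrite /walk_cdf /walk_prob big_pred0 ?mul0r// => w /=.
  apply/negbTE; rewrite -ltNge; apply: lt_le_trans x0 _.
  by rewrite divr_ge0 ?sqrtr_ge0// ler0z height_ge0.
have sv0 : 0 < Num.sqrt v by rewrite sqrtr_gt0.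
have := @stay_cvg_half_normal _ _ _ p_gt0 P1 _ _ step_mean step_variance v0 (x / Num.sqrt v) mu0.
rewrite divr_ge0 ?sqrtr_ge0// => /(_ isT); apply: cvg_trans; apply: near_eq_cvg.
near=> n; have n0 : (0 < n)%N by near: n; exact: nbhs_infty_gt.
rewrite mulrA divfK ?gt_eqF// -[x * _]add0r -walk_cdfE ?sqrtr_gt0 ?ltr0n//.
by under eq_fun do rewrite subr0.
Unshelve. all: by end_near. Qed.

Lemma height_cvg_normal : 0 < P' 1 ->
  cvg_in_distribution
    (fun n => walk_cdf p (fun w : n.-tuple S =>
       ((height w)%:~R - mu * n%:R) / (Num.sqrt v * Num.sqrt n%:R)))
    (normal_prob 0 1).
Proof.
move=> d0; rewrite /cvg_in_distribution /= => x _; have v0 := step_variance_gt0.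
have mu0 : 0 < mu by rewrite divr_gt0.
have := @stay_cvg_normal _ _ _ p_gt0 P1 _ _ step_mean step_variance v0 x mu0.
apply: cvg_trans; apply: near_eq_cvg.
near=> n; have n0 : (0 < n)%N by near: n; exact: nbhs_infty_gt.
by rewrite walk_cdfE// mulr_gt0 ?sqrtr_gt0 ?ltr0n.
Unshelve. all: by end_near. Qed.

End CriticalAndPositiveDrift.

(** * Power series of a product of geometric series *)

Section ReciprocalSeries.
Variable K : numFieldType.
Implicit Types (b c : nat -> K) (v u : K) (n : nat).

Definition trunc_series b n : {poly K} := \sum_(i < n) b i *: 'X^i.

Lemma trunc_seriesS b n : trunc_series b n.+1 = trunc_series b n + b n *: 'X^n.
Proof. by rewrite /trunc_series big_ord_recr. Qed.

Lemma coef_trunc_series b n k : (trunc_series b n)`_k = if (k < n)%N then b k else 0.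
Proof.
have -> : trunc_series b n = \poly_(i < n) b i by rewrite poly_def.
by rewrite coef_poly.
Qed.

Lemma horner_trunc_series b n u : (trunc_series b n).[u] = \sum_(k < n) b k * u ^+ k.
Proof. by rewrite horner_sum; apply: eq_bigr => k _; rewrite hornerZ hornerXn. Qed.

(** The coefficients of [B(u) / (1 - u / v)], where [B] is the series with
    coefficients [b]. *)
Fixpoint geom_div v b n : K := if n is m.+1 then b n + geom_div v b m / v else b 0%N.

Definition delay c n : K := if n is m.+1 then c m else 0.

Lemma geom_divE v b n : geom_div v b n = b n + delay (geom_div v b) n / v.
Proof. by case: n => [|n] //=; rewrite mul0r addr0. Qed.

(** Truncation to degree less than [n] turns the identity of power series
    [(1 - u / v) C(u) = B(u)] into one of polynomials, with one extra term of
    degree [n]. *)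
Lemma trunc_series_geom_div v b n :
  (1 - v^-1 *: 'X) * trunc_series (geom_div v b) n =
  trunc_series b n - (delay (geom_div v b) n / v) *: 'X^n.
Proof.
elim: n => [|n IH].
  by rewrite /trunc_series !big_ord0 mulr0 mul0r scale0r subrr.
rewrite !trunc_seriesS mulrDr IH /= mulrBl mul1r -scalerAl -scalerAr -exprS scalerA.
rewrite [geom_div v b n in X in _ + (X - _)]geom_divE scalerDl.
rewrite (mulrC v^-1) (addrC (b n *: _)) !addrA; congr (_ - _).
by rewrite subrK.
Qed.

Lemma geom_div1 b n : geom_div 1 b n = \sum_(k < n.+1) b k.
Proof.
elim: n => [|n IH]; first by rewrite big_ord_recl big_ord0 addr0.
by rewrite big_ord_recr /= -IH divr1 addrC.
Qed.

Lemma geom_div_le v b (r C : K) : 0 < r -> 1 < r * `|v| ->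
  (forall k, `|b k| <= C * r ^+ k) ->
  forall k, `|geom_div v b k| <= C / (1 - (r * `|v|)^-1) * r ^+ k.
Proof.
move=> r0 rv bC; set t := (r * `|v|)^-1.
have rv0 : 0 < r * `|v| by apply: lt_trans rv.
have v0 : 0 < `|v| by rewrite -(pmulr_rgt0 _ r0).
have t0 : 0 < t by rewrite invr_gt0.
have t1 : 0 < 1 - t by rewrite subr_gt0 invf_lt1.
have C0 : 0 <= C by have := le_trans (normr_ge0 _) (bC 0%N); rewrite expr0 mulr1.
have CE : C + C / (1 - t) * t = C / (1 - t) by field; rewrite gt_eqF.
elim=> [|k IH] /=.
  apply: le_trans (bC 0%N) _; rewrite ler_wpM2r// -CE lerDl.
  by rewrite mulr_ge0 ?divr_ge0// ltW.
apply: le_trans (ler_normD _ _) _; rewrite -CE mulrDl lerD//.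
rewrite normrM normfV; apply: le_trans (ler_wpM2r _ IH) _; first by rewrite invr_ge0 ltW.
have tE : r ^+ k / `|v| = t * r ^+ k.+1 by rewrite /t exprS; field; rewrite !gt_eqF.
by rewrite -[leLHS]mulrA tE mulrA.
Qed.

(** By induction on the list, dividing by one factor at a time.  The growth
    bound on the coefficients is what controls the extra term above, hence
    also the speed of convergence of the partial sums. *)
Lemma reciprocal_series (vs : seq K) (r : K) : 0 < r ->
  (forall v, v \in vs -> 1 < r * `|v|) ->
  exists b : nat -> K,
  [/\ exists C, forall k, `|b k| <= C * r ^+ k,
      forall n, exists Q, \prod_(v <- vs) (1 - v^-1 *: 'X) * trunc_series b n = 1 + Q * 'X^n &
      forall u, r * `|u| < 1 -> exists D, forall n,
        `|\sum_(k < n) b k * u ^+ k - \prod_(v <- vs) (1 - u / v)^-1| <= D * (r * `|u|) ^+ n].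
Proof.
move=> r0; elim: vs => [|v vs IH] rvs.
  exists (fun k => (k == 0%N)%:R); split.
  - exists 1 => -[|k]; first by rewrite normr1 expr0 mulr1.
    by rewrite normr0 mul1r exprn_ge0// ltW.
  - case=> [|n]; first by exists (-1); rewrite /trunc_series big_ord0 mulr0 expr0 mulr1 subrr.
    exists 0; rewrite big_nil mul1r mul0r addr0 /trunc_series big_ord_recl /= scale1r expr0.
    by rewrite big1 ?addr0// => i _; rewrite scale0r.
  - move=> u ru; exists 1 => -[|n]; first by rewrite big_nil big_ord0 sub0r normrN normr1 mul1r.
    rewrite big_nil big_ord_recl big1 ?addr0 /= ?mul1r ?subrr ?normr0 => [|i _].
      by rewrite exprn_ge0// mulr_ge0// ltW.
    by rewrite mul0r.
have [|b [[C bC] bQ bV]] := IH; first by move=> w wvs; apply: rvs; rewrite inE wvs orbT.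
have rv : 1 < r * `|v| by apply: rvs; rewrite inE eqxx.
have v0 : 0 < `|v| by rewrite -(pmulr_rgt0 _ r0) (lt_trans ltr01).
have C0 : 0 <= C by have := le_trans (normr_ge0 _) (bC 0%N); rewrite expr0 mulr1.
have cC := geom_div_le r0 rv bC; set C' := C / _ in cC.
have C'0 : 0 <= C' by have := le_trans (normr_ge0 _) (cC 0%N); rewrite expr0 mulr1.
exists (geom_div v b); split; first by exists C'.
- move=> n; have [Q bQn] := bQ n.
  exists (Q - \prod_(v <- vs) (1 - v^-1 *: 'X) * (delay (geom_div v b) n / v)%:P).
  rewrite big_cons mulrAC trunc_series_geom_div mulrC mulrBr bQn -mul_polyC; ring.
- move=> u ru; have [D bD] := bV u ru.
  exists ((D + C' / (r * `|v|)) / `|1 - u / v|) => n.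
  have uv : `|u| < `|v| by rewrite -(ltr_pM2l r0) (lt_trans ru).
  have d0 : 1 - u / v != 0.
    rewrite subr_eq0; apply: contraTneq uv => uv1.
    by rewrite -[u](@divfK _ v) -?normr_gt0// -uv1 mul1r ltxx.
  have E : (1 - u / v) * \sum_(k < n) geom_div v b k * u ^+ k =
      \sum_(k < n) b k * u ^+ k - delay (geom_div v b) n / v * u ^+ n.
    have := congr1 (fun q => q.[u]) (trunc_series_geom_div v b n).
    rewrite hornerM !hornerD !hornerN !hornerZ hornerC hornerX hornerXn !horner_trunc_series.
    by rewrite [v^-1 * u]mulrC.
  rewrite big_cons.
  have -> : \sum_(k < n) geom_div v b k * u ^+ k - (1 - u / v)^-1 * \prod_(w <- vs) (1 - u / w)^-1
    = (\sum_(k < n) b k * u ^+ k - \prod_(w <- vs) (1 - u / w)^-1 - delay (geom_div v b) n / v * u ^+ n)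
       / (1 - u / v).
    by apply: (mulfI d0); rewrite [RHS]mulrC divfK// mulrBr E mulrA divff// mul1r addrAC.
  rewrite normrM normfV [leRHS]mulrAC ler_wpM2r ?invr_ge0// mulrDl.
  apply: le_trans (ler_normB _ _) _; apply: lerD => //.
  rewrite !normrM normrX normfV exprMn.
  case: n {E bD bQ bV} => [|n] /=.
    by rewrite normr0 !mul0r !expr0 !mulr1 divr_ge0// mulr_ge0// ltW.
  rewrite mulrA ler_wpM2r ?exprn_ge0//.
  apply: le_trans (ler_wpM2r _ (cC n)) _; first by rewrite invr_ge0.
  by rewrite le_eqVlt; apply/orP; left; apply/eqP; rewrite exprS; field; rewrite !gt_eqF.
Qed.

End ReciprocalSeries.

(** * The kernel polynomial as a recursion *)

Section KernelRecurrence.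
Variables (R : realType) (S : {fset int}) (p : int -> R).
Local Notation C := (R[i]).
Local Notation c := (step_c S).

Lemma step_c_ge (s : int) : s \in S -> 0 <= s + c%:Z.
Proof.
move=> sS; rewrite /step_c.
have m0 : \big[Num.min/0]_(s <- S) s <= 0 :> int by exact: bigmin_le_id.
have ms : \big[Num.min/0]_(s <- S) s <= s by exact: (@ge_bigmin_seq _ _ _ _ _ s xpredT id).
by rewrite -abszN gez0_abs ?oppr_ge0// subr_ge0.
Qed.

Definition extend0 (q : nat -> C) (k : int) : C := if k is Posz n then q n else 0.

(** Multiplication by [u^c (1 - z P(u))] acts on coefficients as the walk
    recursion, delayed by [c]. *)
Lemma coef_kernel_mul (z : C) (T : {poly C}) (y : nat) :
  (kernel_poly S p z * T)`_(y + c) =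
  T`_y - z * \sum_(s <- S) (p s)%:C * extend0 (fun k => T`_k) (y%:Z - s).
Proof.
rewrite /kernel_poly mulrBl coefB coefXnM ltnNge leq_addl /= addnK; congr (_ - _).
rewrite -scalerAl coefZ; congr (_ * _).
rewrite mulr_suml coef_sum !big_seq; apply: eq_bigr => s sS.
rewrite -scalerAl coefZ coefXnM; congr (_ * _).
have := step_c_ge sS; case sE: (s + c%:Z) => [k|//] _.
have -> : y%:Z - s = (y + c)%:Z - k%:Z by rewrite PoszD -sE; ring.
rewrite /=; case: ltnP => yk; last by rewrite subzn.
by rewrite -opprB subzn ?(ltnW yk)//; case: (k - (y + c))%N (subn_gt0 (y+c) k) => //; rewrite yk.
Qed.

(** The root 1 is one of the [u i], because it is not one of the [v j]; taking
    it out leaves [c - 1] other roots, hence the degree of [N]. *)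
Lemma kernel_factor (z : C) (u : 'I_c -> C) (m : nat) (v : 'I_m -> C) :
  kernel_poly S p z = lead_coef (kernel_poly S p z) *:
    (\prod_i ('X - (u i)%:P) * \prod_j ('X - (v j)%:P)) ->
  (kernel_poly S p z).[1] = 0 -> kernel_poly S p z != 0 ->
  (forall j, v j != 0) -> (forall j, v j != 1) ->
  exists2 N : {poly C}, (size N <= c)%N &
    kernel_poly S p z = N * (1 - 'X) * \prod_j (1 - (v j)^-1 *: 'X).
Proof.
set l := lead_coef _ => KE; rewrite KE hornerZ hornerM => /eqP.
rewrite -{1}KE -/l => + K0.
have l0 : l != 0 by apply: contraNneq K0 => l0; rewrite KE l0 scale0r.
rewrite !mulf_eq0 (negbTE l0) /= !horner_prod => + v0 v1.
have -> : (\prod_(j < m) ('X - (v j)%:P).[1] == 0) = false.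
  apply/negbTE/prodf_neq0 => j _.
  by rewrite !hornerE subr_eq0 eq_sym.
rewrite orbF => /prodf_eq0[i0 _]; rewrite !hornerE subr_eq0 => /eqP u1.
exists (- l * \prod_j (- v j) *: \prod_(i | i != i0) ('X - (u i)%:P)).
  apply: leq_trans (size_scale_leq _ _) _.
  have := size_prod_XsubC (enum 'I_c) u; rewrite -cardE card_ord big_enum /=.
  rewrite (bigD1 i0)//= size_mul ?polyXsubC_eq0 //; last first.
    by apply/prodf_neq0 => i _; rewrite polyXsubC_eq0.
  by rewrite size_XsubC addSn /= add1n => -[->].
have -> : \prod_j ('X - (v j)%:P) = \prod_j (- v j) *: \prod_j (1 - (v j)^-1 *: 'X).
  rewrite -mul_polyC rmorph_prod -big_split /=; apply: eq_bigr => j _.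
  rewrite mulrBr mulr1 mul_polyC scalerA mulNr divff// scaleN1r opprK polyCN addrC //.
rewrite (bigD1 i0)//= -u1 polyC1 -!mul_polyC polyCM polyCN; ring.
Qed.

(** The sequence [q] has generating function [1 / ((1 - u) L(u))].  Its product
    with the kernel is therefore [N], whose coefficients of degree at least
    [c] vanish; these are the equations of the recursion. *)
Lemma kernel_recurrence (z : C) (N L : {poly C}) (b : nat -> C) :
  (size N <= c)%N -> kernel_poly S p z = N * (1 - 'X) * L ->
  (forall n, exists Q, L * trunc_series b n = 1 + Q * 'X^n) ->
  forall y : nat, let q k := \sum_(i < k.+1) b i in
  q y = z * \sum_(s <- S) (p s)%:C * extend0 q (y%:Z - s).
Proof.
move=> sN KE bQ y q.
set n := (y + c).+1; set T := trunc_series (geom_div 1 b) n.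
have [Q bQn] := bQ n.
have KT : kernel_poly S p z * T = N + N * (Q - L * (delay (geom_div 1 b) n)%:P) * 'X^n.
  have := trunc_series_geom_div 1 b n; rewrite !invr1 scale1r mulr1 -/T => E.
  have -> : kernel_poly S p z * T = N * L * ((1 - 'X) * T) by rewrite KE; ring.
  rewrite E mulrBr -[N * L * trunc_series b n]mulrA bQn -mul_polyC; ring.
have T_coef k : (k <= y + c)%N -> T`_k = q k.
  by move=> ky; rewrite coef_trunc_series ltnS ky geom_div1.
have := coef_kernel_mul z T y; rewrite KT coefD coefMXn ltnS leqnn addr0.
rewrite nth_default ?(leq_trans sN) ?leq_addl// => /esym/eqP; rewrite subr_eq0 => /eqP.
rewrite T_coef ?leq_addr// => ->; congr (_ * _).
rewrite !big_seq; apply: eq_bigr => s sS; congr (_ * _).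
have : y%:Z - s <= (y + c)%:Z by rewrite PoszD lerD2l -subr_ge0 opprK addrC step_c_ge.
by case: (y%:Z - s) => k //= yk; rewrite T_coef.
Qed.

End KernelRecurrence.

(** * The large branches stay outside the critical circle *)

Section LargeBranches.
Variables (R : realType) (S : {fset int}) (p : int -> R).
Hypothesis p_gt0 : forall s, s \in S -> 0 < p s.
Hypothesis S_neg : exists2 s, s \in S & s < 0.
Variable tau : R.
Hypothesis tau_gt0 : 0 < tau.
Local Notation rho := (1 / step_poly S p tau).
Local Notation c := (step_c S).

Let Ptau : 0 < step_poly S p tau := step_poly_gt0 S_neg p_gt0 tau_gt0.

(** On the circle, [|x w^c P(w)| <= x tau^c P(tau) < tau^c = |w^c|]. *)
Lemma kernel_no_root (x : R) (w : R[i]) : 0 < x < rho -> `|w| = tau%:C ->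
  (kernel_poly S p x%:C).[w] != 0.
Proof.
move=> /andP[x0 xr] wt; rewrite /kernel_poly hornerD hornerN hornerZ hornerXn horner_sum subr_eq0.
apply/eqP => E.
have x0C : 0 <= x%:C by rewrite (lecR 0) ltW.
have : `|w ^+ c| <= (x * (tau ^+ c * step_poly S p tau))%:C.
  rewrite E normrM (ger0_norm x0C) rmorphM ler_wpM2l//.
  apply: le_trans (ler_norm_sum _ _ _) _.
  rewrite mulr_sumr rmorph_sum /= !big_seq; apply: ler_sum => s sS.
  rewrite hornerZ hornerXn normrM normrX wt ger0_norm ?(lecR 0) ?(ltW (p_gt0 sS))//.
  rewrite -rmorphXn -rmorphM lecR.
  have -> : tau ^+ `|s + c%:Z| = tau ^+ c * tau ^ s.
    have := step_c_ge sS; case sE: (s + c%:Z) => [k|//] _ /=.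
    by rewrite -[tau ^+ k]/(tau ^ k%:Z) -sE expfzDr ?gt_eqF// mulrC.
  by rewrite mulrCA.
rewrite normrX wt -rmorphXn lecR mulrCA ler_pMr ?exprn_gt0// leNgt => /negP; apply.
by rewrite -ltr_pdivlMr.
Qed.

(** The indicator of [f] is continuous and would take the value 1/2. *)
Lemma locally_constant_segment (f : R -> bool) (a b : R) : a <= b ->
  (forall x, x \in `[a, b] -> \forall y \near x, f y = f x) -> f a = f b.
Proof.
move=> ab fc; pose g x : R := (f x)%:R.
have cg : {within `[a, b], continuous g}.
  apply: continuous_in_subspaceT => x /[!inE] xab.
  apply: cvg_near_cst; near=> y.
  have fyx : f y = f x.
    by near: y; exact: fc.
  by rewrite /g fyx.
have half : Num.min (g a) (g b) <= 2^-1 <= Num.max (g a) (g b) -> False.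
  by move=> /(IVT ab cg)[x _]; rewrite /g; case: (f x) => /= H; lra.
have h01 : 0 <= (2^-1 : R) <= 1 by apply/andP; split; lra.
move: half; rewrite /g; case: (f a); case: (f b) => //= half; case: half.
  by rewrite min_r ?max_l ?ler01.
by rewrite min_l ?max_r ?ler01.
Unshelve. all: by end_near. Qed.

Variables (u : 'I_c -> (R[i])^o -> (R[i])^o)
  (v : 'I_(step_d S) -> (R[i])^o -> (R[i])^o).
Hypothesis branches : kernel_branches p rho u v.

Let large (x : R) : bool := [forall j, tau%:C < `|v j x%:C|].

Lemma complex_gt0 (e : R[i]) : 0 < e -> exists2 e0 : R, 0 < e0 & e = e0%:C.
Proof.
move=> e0; have /ger0_Im := ltW e0; case: e e0 => a b /= e0 b0; subst b.
by exists a => //; rewrite -ltcR.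
Qed.

Lemma branch_norm_neq (x : R) j : 0 < x < rho -> `|v j x%:C| != tau%:C.
Proof.
move=> xr; case: branches => r r0 [fact _ _ _].
apply/eqP => /(kernel_no_root xr); rewrite fact; last by right; exists x.
have z : (\prod_i ('X - (v i x%:C)%:P)).[v j x%:C] = 0.
  by rewrite horner_prod (bigD1 j)//= hornerXsubC subrr mul0r.
by rewrite hornerZ hornerM z !mulr0 eqxx.
Qed.

Lemma large_near0 : exists2 e : R, 0 < e & forall x, 0 < x < rho -> x < e -> large x.
Proof.
case: branches => r r0 [_ _ vy _].
have H : \forall z \near within (branch_domain r rho) (nbhs (0 : (R[i])^o)),
    forall j, tau%:C < `|v j z|.
  apply: filter_forall => j; apply: (vy j [set y | tau%:C < y]).
  by exists tau%:C; split => //; apply: ger0_real; rewrite (lecR 0) ltW.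
have /nbhs_ballP[e e0 He] : nbhs (0 : (R[i])^o) [set z | branch_domain r rho z -> forall j, tau%:C < `|v j z|].
  exact: H.
have [e' e'0 eE] := complex_gt0 e0; exists e' => // x xr xe.
apply/forallP; apply: He; last by right; exists x.
rewrite /ball /= sub0r normrN ger0_norm ?(lecR 0); last by case/andP: xr => /ltW.
by rewrite eE ltcR.
Qed.

Lemma closer_same_side (a b t : R) : `|a - b| < `|b - t| -> (t < a) = (t < b).
Proof.
rewrite ltr_norml => /andP[h1 h2]; case: (ltP t b) => tb.
  by move: h1; rewrite ger0_norm ?subr_ge0 ?(ltW tb)// => h1; apply/idP; lra.
move: h2; rewrite ler0_norm ?subr_le0// => h2; apply/negbTE; rewrite -leNgt; lra.
Qed.

Lemma complex_norm_real (z : R[i]) : `|z| = (complex.Re `|z|)%:C.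
Proof. by rewrite normc_def. Qed.

(** Take the tolerance smaller than the distance from every [|v_j|] to [tau],
    which is positive by [branch_norm_neq]: the matched branches at a nearby
    point are then on the same side of the circle. *)
Lemma large_locally_constant (x : R) : 0 < x < rho -> \forall y \near x, large y = large x.
Proof.
move=> xr; case: branches => r r0 [_ _ _ cont].
pose N (z : R[i]) : R := complex.Re `|z|.
have largeE y j : (tau%:C < `|v j y%:C|) = (tau < N (v j y%:C)).
  by rewrite complex_norm_real ltcR.
pose e := \big[Num.min/1]_j `|N (v j x%:C) - tau|.
have e0 : 0 < e.
  apply/bigmin_gtP; split=> // j _; rewrite normr_gt0 subr_eq0.
  have := branch_norm_neq j xr; apply: contraNneq => <-.
  by rewrite -complex_norm_real.
have xD : branch_domain r rho x%:C by right; exists x.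
have /nbhs_ballP[d d0 Hd] : nbhs (x%:C : (R[i])^o) [set z | branch_domain r rho z ->
    exists s : 'S_(step_d S), forall j, `|v j z - v (s j) x%:C| < e%:C].
  by apply: cont => //; rewrite (ltcR 0).
have [d' d'0 dE] := complex_gt0 d0.
near=> y.
have y0 : 0 < y by near: y; apply: lt_nbhsr; case/andP: xr.
have yrho : y < rho by near: y; apply: lt_nbhsl; case/andP: xr.
have yr : 0 < y < rho by rewrite y0.
have yd : ball x d' y by near: y; exact: nbhsx_ballx.
have [||s Hs] := Hd y%:C; [|by right; exists y|].
  by move: yd; rewrite /ball /= dE -rmorphB /= normc_def /= expr0n addr0 sqrtr_sqr ltcR.
have close j : (tau%:C < `|v j y%:C|) = (tau%:C < `|v (s j) x%:C|).
  rewrite !largeE; apply: closer_same_side.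
  apply: (@lt_le_trans _ _ e); last exact: (bigmin_le 1 (s j) (fun j => `|N (v j x%:C) - tau|)).
  have := le_lt_trans (ler_dist_dist _ _) (Hs j).
  rewrite (complex_norm_real (v j y%:C)) (complex_norm_real (v (s j) x%:C)).
  by rewrite -rmorphB /= normc_def /= expr0n addr0 sqrtr_sqr ltcR.
apply/idP/idP => /forallP H; apply/forallP => j; last by rewrite close.
by have := H ((s^-1)%g j); rewrite close permKV.
Unshelve. all: by end_near. Qed.

Lemma branch_large (x : R) : 0 < x < rho -> forall j, tau%:C < `|v j x%:C|.
Proof.
move=> xr; apply/forallP; rewrite -/(large x).
have [e e0 He] := large_near0.
have [x0 xrho] := andP xr.
pose x1 := Num.min x e / 2.
have m0 : 0 < Num.min x e by rewrite lt_min x0.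
have mx : Num.min x e <= x by rewrite ge_min lexx.
have me : Num.min x e <= e by rewrite ge_min lexx orbT.
have x1x : x1 < x by rewrite /x1; lra.
have x1e : x1 < e by rewrite /x1; lra.
have x10 : 0 < x1 by rewrite divr_gt0.
rewrite -(@locally_constant_segment large x1 x (ltW x1x)).
  by apply: He => //; rewrite x10 (lt_trans x1x).
move=> y; rewrite in_itv /= => /andP[x1y yx]; apply: large_locally_constant.
by rewrite (lt_le_trans x10)// (le_lt_trans yx).
Qed.

End LargeBranches.

(** * The discrete limit law for negative drift *)

Section ComplexBounds.
Variable R : realType.

Lemma complex_ge0 (D : R[i]) : 0 <= D -> exists2 d : R, 0 <= d & D = d%:C.
Proof.
move=> D0; have := ger0_Im D0; case: D D0 => a b /= ab b0; subst b.
by exists a => //; rewrite -lecR.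
Qed.

Lemma real_limit (x : nat -> R) (z : R[i]) (E : nat -> R) :
  (forall n, `|(x n)%:C - z| <= (E n)%:C) -> E n @[n --> \oo] --> (0 : R) ->
  x n @[n --> \oo] --> complex.Re z /\ (complex.Re z)%:C = z.
Proof.
case: z => a b /= xE E0.
have H n : Num.sqrt ((x n - a) ^+ 2 + b ^+ 2) <= E n.
  by have := xE n; rewrite normc_def /= sub0r sqrrN lecR.
have sum_ge0 n : 0 <= (x n - a) ^+ 2 + b ^+ 2 by rewrite addr_ge0 ?sqr_ge0.
have b0 : b = 0.
  apply/eqP; rewrite -normr_le0 -sqrtr_sqr.
  apply: (cvgr_to_ge E0); near=> n; apply: le_trans (H n).
  by rewrite ler_wsqrtr// lerDr sqr_ge0.
split; last by rewrite b0.
have xa n : `|x n - a| <= E n.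
  by apply: le_trans (H n); rewrite -sqrtr_sqr ler_wsqrtr// lerDl sqr_ge0.
apply/subr_cvg0; apply: (@squeeze_cvgr _ _ _ _ (fun n => - E n) E) => //.
  by near=> n; rewrite -ler_norml xa.
by rewrite -[X in _ --> X]oppr0; apply: cvgN.
Unshelve. all: by end_near. Qed.

Lemma complex_cvg_geometric (z : nat -> (R[i])^o) (l : (R[i])^o) (D g : R) :
  0 <= g < 1 -> (forall n, `|z n - l| <= (D * g ^+ n)%:C) -> z n @[n --> \oo] --> l.
Proof.
move=> /andP[g0 g1] zE; apply/cvgrPdist_lt => e e0.
have [e' e'0 eE] := complex_gt0 e0.
have g1' : `|g| < 1 by rewrite ger0_norm.
have H := proj1 (cvgrPdist_lt _ _) (cvg_geometric D g1') e' e'0.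
near=> n; rewrite distrC; apply: le_lt_trans (zE n) _; rewrite eE ltcR.
apply: le_lt_trans (ler_norm _) _; rewrite -normrN -sub0r; near: n; exact: H.
Unshelve. all: by end_near. Qed.

End ComplexBounds.

Section NegativeDrift.
Variables (R : realType) (S : {fset int}) (p : int -> R).
Hypothesis p_gt0 : forall s, s \in S -> 0 < p s.
Hypothesis S_neg : exists2 s, s \in S & s < 0.
Let P1 : 0 < step_poly S p 1 := step_poly_gt0 S_neg p_gt0 ltr01.
Local Notation pr := (step_prob S p).
Local Notation stay := (stay_prob S p).

Lemma walk_prob_height_eq (n k : nat) :
  walk_prob p (fun w : n.-tuple S => height w == k%:Z) =
  stay n k%:R - stay n (k%:R - 1).
Proof.
rewrite -!walk_prob_height_le// !walk_prob_sum// -mulrBl -sumrB; congr (_ / _).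
apply: eq_bigr => w _; rewrite -mulrBl; congr (_ * _).
have -> : (height w)%:~R <= k%:R - 1 :> R = (height w < k%:Z).
  by rewrite -[k%:R - 1](@intrB R k 1) ler_int lerBrDr lezD1.
rewrite -[k%:R]/(k%:Z%:~R) ler_int.
by case: ltgtP => _; rewrite ?subrr ?subr0.
Qed.

(** A geometric weight [tau ^ (- y)] is multiplied by [P(tau) / P(1)] under
    averaging over a step. *)
Lemma weighted_contraction (tau A : R) (f : nat -> int -> R[i]) : 0 < tau -> 0 <= A ->
  (forall n y, y < 0 -> f n y = 0) ->
  (forall y, 0 <= y -> `|f 0%N y| <= (A * tau ^ (- y))%:C) ->
  (forall n y, 0 <= y -> f n.+1 y = \sum_(s <- S) (pr s)%:C * f n (y - s)) ->
  forall n y, `|f n y| <=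
    (A * (step_poly S p tau / step_poly S p 1) ^+ n * tau ^ (- y))%:C.
Proof.
move=> t0 A0 fneg f0 fS; elim=> [|n IH] y; have [y0|y0] := ltP y 0.
- by rewrite fneg// normr0 (lecR 0) !mulr_ge0 ?expr0// ltW// exprz_gt0.
- by rewrite expr0 mulr1 f0.
- rewrite fneg// normr0 (lecR 0) !mulr_ge0 ?exprn_ge0 ?divr_ge0 ?(ltW (exprz_gt0 _ t0)) ?(ltW P1)//.
  by rewrite ltW// step_poly_gt0.
rewrite fS//; apply: le_trans (ler_norm_sum _ _ _) _.
have -> : A * (step_poly S p tau / step_poly S p 1) ^+ n.+1 * tau ^ (- y) =
    \sum_(s <- S) pr s * (A * (step_poly S p tau / step_poly S p 1) ^+ n * tau ^ (- (y - s))).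
  set B := A * _ ^+ n.
  under eq_bigr => s _.
    have -> : pr s * (B * tau ^ (- (y - s))) = p s * tau ^ s * (B * tau ^ (- y) / step_poly S p 1).
      by rewrite opprB expfzDr ?gt_eqF// /step_prob; ring.
    over.
  by rewrite -mulr_suml -/(step_poly S p tau) exprS /B; ring.
rewrite rmorph_sum /= !big_seq; apply: ler_sum => s sS.
have pr0 : 0 <= (pr s)%:C by rewrite (lecR 0) step_prob_ge0.
by rewrite normrM (ger0_norm pr0) [leRHS]rmorphM ler_wpM2l//; apply: IH.
Qed.

Variables (tau : R) (u : 'I_(step_c S) -> (R[i])^o -> (R[i])^o)
  (v : 'I_(step_d S) -> (R[i])^o -> (R[i])^o).
Hypothesis tau_gt0 : 0 < tau.
Hypothesis tau_crit : derive1 (step_poly S p) tau = 0.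
Hypothesis drift : derive1 (step_poly S p) 1 < 0.
Hypothesis branches : kernel_branches p (1 / step_poly S p tau) u v.
Local Notation rho1 := (1 / step_poly S p 1).

Lemma tau_neq1 : tau != 1.
Proof. by apply: contraTneq drift => <-; rewrite tau_crit ltxx. Qed.

Lemma step_poly_tau_lt : step_poly S p tau < step_poly S p 1.
Proof.
have := step_poly_tangent p_gt0 S_neg tau_gt0 ltr01 tau_neq1.
by rewrite tau_crit mulr0 addr0.
Qed.

Lemma tau_gt1 : 1 < tau.
Proof.
have := step_poly_tangent p_gt0 S_neg ltr01 tau_gt0; rewrite eq_sym tau_neq1 => /(_ isT) H.
rewrite ltNge; apply/negP => t1; move: H; apply/negP; rewrite -leNgt.
apply: le_trans (ltW step_poly_tau_lt) _.
by rewrite lerDl mulr_le0// ?subr_le0// ltW.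
Qed.

Lemma rho1_in : 0 < rho1 < 1 / step_poly S p tau.
Proof.
have Pt : 0 < step_poly S p tau by apply: step_poly_gt0.
by rewrite !div1r invr_gt0 P1 ltf_pV2 ?posrE// step_poly_tau_lt.
Qed.

(** The error [f n y] is the difference between [stay_prob] and its candidate
    limit; both satisfy the recursion, and at time 0 it is a tail of the
    convergent series of the [b k], of order [tau ^ (- y)]. *)
Lemma height_cvg_discrete : exists a : nat -> R,
  [/\ power_series_at0 (omega v rho1%:C) (fun k => (a k)%:C),
      forall k : nat,
        walk_prob p (fun w : n.-tuple S => height w == k%:Z) @[n --> \oo] --> a k &
      series a @ \oo --> (1 : R)].
Proof.
pose w j : R[i] := v j rho1%:C.
have w_large j : tau%:C < `|w j|.
  have H := branch_large p_gt0 S_neg tau_gt0 branches rho1_in j.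
  exact: H.
have t1 := tau_gt1.
have w0 j : w j != 0.
  by rewrite -normr_gt0; apply: lt_trans (w_large j); rewrite (ltcR 0).
have w1 j : w j != 1.
  apply: contraTneq (w_large j) => ->; rewrite normr1 (ltcR _ 1) -leNgt ltW//.
(* The v_j are outside |u| = tau, so the b k are O(tau^-k) and the series
   converges on a disc which contains 1. *)
pose r : R[i] := (tau^-1)%:C.
have r0 : 0 < r by rewrite (ltcR 0) invr_gt0.
pose vs := [seq w j | j <- enum 'I_(step_d S)].
have prod_vs (T : comNzRingType) (F : R[i] -> T) : \prod_(z <- vs) F z = \prod_j F (w j).
  by rewrite big_map big_enum.
have vs_large z : z \in vs -> 1 < r * `|z|.
  have <- : r * tau%:C = 1 by rewrite -rmorphM /= mulVf ?gt_eqF.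
  by case/mapP => j _ ->; rewrite ltr_pM2l.
have [b [_ bQ bV]] := reciprocal_series r0 vs_large.
pose V1 := \prod_(z <- vs) (1 - 1 / z)^-1.
have V1_neq0 : V1 != 0.
  rewrite /V1 prod_vs; apply/prodf_neq0 => j _.
  rewrite invr_eq0 subr_eq0 eq_sym div1r; apply: contra (w1 j) => /eqP wj.
  by rewrite -[w j]invrK wj invr1.
have [N N0 NE] : exists2 N : R, 0 < N & `|V1| = N%:C by apply: complex_gt0; rewrite normr_gt0.
have r1 : r * `|1| < 1 by rewrite normr1 mulr1 (ltcR _ 1) invf_lt1.
have [D bD] := bV 1 r1.
have [d d0 DE] : exists2 d : R, 0 <= d & D = d%:C.
  by apply: complex_ge0; have := le_trans (normr_ge0 _) (bD 0%N); rewrite expr0 mulr1.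
pose A := d / N.
have A0 : 0 <= A by rewrite divr_ge0// ltW.
have sum_bound n : `|(\sum_(k < n) b k) / V1 - 1| <= (A * tau^-1 ^+ n)%:C.
  have E1 : \sum_(k < n) b k * 1 ^+ k = \sum_(k < n) b k.
    by apply: eq_bigr => k _; rewrite expr1n mulr1.
  have := bD n; rewrite E1 -/V1 normr1 mulr1 DE -rmorphXn -rmorphM => H.
  have -> : (\sum_(k < n) b k) / V1 - 1 = (\sum_(k < n) b k - V1) / V1.
    by rewrite mulrBl divff.
  rewrite normrM normfV NE -fmorphV /A mulrAC rmorphM ler_wpM2r// (lecR 0) invr_ge0 ltW//.
pose K := kernel_poly S p rho1%:C.
have K1 : K.[1] = 0.
  rewrite /K /kernel_poly hornerD hornerN hornerZ hornerXn horner_sum expr1n.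
  under eq_bigr do rewrite hornerZ hornerXn expr1n mulr1.
  by rewrite -rmorph_sum -step_poly1 -rmorphM /= div1r mulVf ?gt_eqF// subrr.
have K_neq0 : K != 0.
  have tC : `|tau%:C| = tau%:C :> R[i] by rewrite ger0_norm// (lecR 0) ltW.
  have := kernel_no_root p_gt0 S_neg tau_gt0 rho1_in tC.
  by apply: contraNneq => KE; rewrite -/K KE horner0.
have [M sM KE] : exists2 M : {poly R[i]}, (size M <= step_c S)%N &
    K = M * (1 - 'X) * \prod_j (1 - (w j)^-1 *: 'X).
  case: branches => r' _ [fact _ _ _].
  apply: (@kernel_factor _ _ _ _ (fun i => u i rho1%:C)) => //.
  by apply: fact; right; exists rho1 => //; exact: rho1_in.
have bQ' n : exists Q, \prod_j (1 - (w j)^-1 *: 'X) * trunc_series b n = 1 + Q * 'X^n.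
  by have [Q] := bQ n; rewrite prod_vs; exists Q.
pose q k := \sum_(i < k.+1) b i.
have q_rec (y : nat) : q y = rho1%:C * \sum_(s <- S) (p s)%:C * extend0 q (y%:Z - s).
  exact: kernel_recurrence sM KE bQ' y.
pose f n (y : int) := (stay n y%:~R)%:C - extend0 q y / V1.
pose theta := step_poly S p tau / step_poly S p 1.
have theta_bounds : 0 <= theta < 1.
  rewrite divr_ge0 ?(ltW P1) ?(ltW (step_poly_gt0 S_neg p_gt0 tau_gt0))//=.
  by rewrite ltr_pdivrMr// mul1r step_poly_tau_lt.
have f_bound n y : `|f n y| <= (A * theta ^+ n * tau ^ (- y))%:C.
  apply: weighted_contraction => // [m [k|k]|[k|k]|m [k|k]] //.
  - by move=> y0; rewrite /f stay_lt0 ?ltrz0// mul0r subrr.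
  - move=> _; rewrite /f /= -normrN opprB.
    have -> : (k%:~R : R) < 0 = false by apply/negbTE; rewrite -leNgt ler0z.
    apply: le_trans (sum_bound k.+1) _; rewrite lecR ler_wpM2l//.
    rewrite -invr_expz -exprnP -exprVn exprSr ler_piMr ?exprn_ge0 ?invr_ge0 ?(ltW tau_gt0)//.
    by rewrite invf_le1 ?(ltW t1).
  - move=> _; rewrite /f stayS ?ler0z//.
    rewrite (q_rec k : extend0 q k = _) rmorph_sum.
    rewrite mulr_sumr mulr_suml -sumrB; apply: eq_bigr => s _.
    rewrite -intrB rmorphM mulrBr; congr (_ - _).
    by rewrite /step_prob -!mulrA mulrA -rmorphM /= div1r [_^-1 * _]mulrC.
have stay_lim y : stay n y%:~R @[n --> \oo] --> complex.Re (extend0 q y / V1) /\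
    (complex.Re (extend0 q y / V1))%:C = extend0 q y / V1.
  apply: (@real_limit _ _ _ (fun n => A * theta ^+ n * tau ^ (- y))) => [n|]; first exact: f_bound.
  under eq_fun do rewrite mulrAC.
  by apply: cvg_geometric; case/andP: theta_bounds => h0 h1; rewrite ger0_norm.
pose a (k : nat) := complex.Re (extend0 q k / V1) - complex.Re (extend0 q (k%:Z - 1) / V1).
have aC k : (a k)%:C = b k / V1.
  have -> : (a k)%:C = (complex.Re (extend0 q k / V1))%:C -
      (complex.Re (extend0 q (k%:Z - 1) / V1))%:C by rewrite -rmorphB.
  rewrite (stay_lim k%:Z).2 (stay_lim (k%:Z - 1)).2 -mulrBl; congr (_ / _).
  case: k => [|k]; first by rewrite /= subr0 /q big_ord_recl big_ord0 addr0.
  have -> : k.+1%:Z - 1 = k by rewrite intS addrAC subrr add0r.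
  by rewrite /= /q big_ord_recr /= addrAC subrr add0r.
have aC_sum (z : R[i]) n : \sum_(0 <= k < n) (a k)%:C * z ^+ k = (\sum_(k < n) b k * z ^+ k) / V1.
  by rewrite big_mkord mulr_suml; apply: eq_bigr => k _; rewrite aC mulrAC.
exists a; split.
- apply/nbhs_ballP; exists tau%:C; first by rewrite /= (ltcR 0).
  move=> z; rewrite /ball /= sub0r normrN => zt.
  have rz : r * `|z| < 1.
    have <- : r * tau%:C = 1 by rewrite -rmorphM /= mulVf ?gt_eqF.
    by rewrite ltr_pM2l.
  have [D' bD'] := bV z rz.
  have [d' d'0 D'E] : exists2 d : R, 0 <= d & D' = d%:C.
    by apply: complex_ge0; have := le_trans (normr_ge0 _) (bD' 0%N); rewrite expr0 mulr1.
  have [g g0 gE] : exists2 g : R, 0 <= g & r * `|z| = g%:C.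
    by apply: complex_ge0; rewrite mulr_ge0// ltW.
  have g1 : 0 <= g < 1 by rewrite g0 -(ltcR g 1) -gE.
  apply: (complex_cvg_geometric (D := d' / N) g1) => n.
  have -> : omega v rho1%:C z = (\prod_(x <- vs) (1 - z / x)^-1) / V1.
    rewrite /V1 !prod_vs -prodf_div; apply: eq_bigr => j _; rewrite -/(w j).
    have zw : z - w j != 0.
      rewrite subr_eq0; apply: contraTneq zt => ->.
      by apply/negP => /lt_trans/(_ (w_large j)); rewrite ltxx.
    have w1' : 1 - w j != 0 by rewrite subr_eq0 eq_sym.
    have E (x : R[i]) : 1 - x / w j = - (x - w j) / w j by field.
    rewrite !E; move: (w j) (w0 j) (z - w j) zw (1 - w j) w1' => W W0 Y Y0 X X0.
    by rewrite invrK invf_div invrN; field; rewrite W0 Y0.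
  rewrite /= aC_sum -mulrBl normrM normfV NE -fmorphV /=.
  have -> : (d' / N * g ^+ n)%:C = D' * (r * `|z|) ^+ n * (N^-1)%:C.
    by rewrite D'E gE -rmorphXn -!rmorphM /= mulrAC.
  by rewrite ler_wpM2r ?(lecR 0) ?invr_ge0 ?(ltW N0)//; exact: bD'.
- move=> k; under eq_fun do rewrite walk_prob_height_eq.
  have := (stay_lim (k%:Z - 1)).1; rewrite intrB.
  exact: cvgB (stay_lim k%:Z).1.
- have S1 n : `|(series a n)%:C - 1| <= (A * tau^-1 ^+ n)%:C.
    have -> : (series a n)%:C = (\sum_(k < n) b k) / V1; last exact: sum_bound.
    rewrite rmorph_sum /= big_mkord mulr_suml.
    by apply: eq_bigr => k _; rewrite aC.
  apply: (real_limit S1 _).1; apply: cvg_geometric.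
  by rewrite ger0_norm ?invr_ge0 ?(ltW tau_gt0)// invf_lt1.
Qed.

End NegativeDrift.

Theorem theorem3p10 (R : realType) (S : {fset int}) (p : int -> R)
    (S_neg : exists2 s, s \in S & s < 0) (S_pos : exists2 s, s \in S & 0 < s)
    (p_gt0 : forall s, s \in S -> 0 < p s) :
  let P : R -> R := step_poly S p in
  let P' : R -> R := derive1 P in
  let P'' : R -> R := derive1 P' in
  let delta : R := P' 1 in
  let rho1 : R := 1 / P 1 in
  [/\ delta < 0 ->
        forall (tau : R) (u : 'I_(step_c S) -> (R[i])^o -> (R[i])^o)
               (v : 'I_(step_d S) -> (R[i])^o -> (R[i])^o),
          0 < tau -> P' tau = 0 -> kernel_branches p (1 / P tau) u v ->
        exists a : nat -> R,
          [/\ power_series_at0 (omega v rho1%:C) (fun k => (a k)%:C),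
              forall k : nat,
                walk_prob p (fun w : n.-tuple S => height w == k%:Z)
                  @[n --> \oo] --> a k &
              series a @ \oo --> (1 : R)],
      delta = 0 ->
        let sigma := Num.sqrt (P'' 1 / P 1) in
        cvg_in_distribution
          (fun n => walk_cdf p
             (fun w : n.-tuple S => (height w)%:~R / Num.sqrt n%:R))
          (half_normal sigma) &
      0 < delta ->
        let mu := P' 1 / P 1 in
        let sigma := Num.sqrt (P'' 1 / P 1 + P' 1 / P 1
                               - (P' 1 / P 1) ^+ 2) in
        cvg_in_distribution
          (fun n => walk_cdf p
             (fun w : n.-tuple S =>
                ((height w)%:~R - mu * n%:R) / (sigma * Num.sqrt n%:R)))
          (normal_prob 0 1)].
Proof.
move=> P P' P'' delta rho1; split.
- move=> drift tau u v tau_gt0 tau_crit branches.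
  exact: height_cvg_discrete p_gt0 S_neg _ _ _ tau_gt0 tau_crit drift branches.
- exact: height_cvg_half_normal.
- exact: height_cvg_normal.
Qed.
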